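(* Let $G$ be a compact, connected, simple Lie group whose Lie algebra $\mathfrak g$ is simply laced and of rank $r$, let ${}^LG$ be its Langlands dual, and let $\tilde G$ be its universal covering group. With $$\mathcal G(G)=\frac{1}{\sqrt{|Z(G)|}}\sum_{\mu\in\mathcal M(G)}e^{\pi\sqrt{-1}\,(\mu|\mu)}$$ denoting the Gauss sum of $G$ (and $\mathcal G({}^LG)$ that of ${}^LG$), one has $$\mathcal G(G)=\overline{\mathcal G({}^LG)}\;e^{\frac{\pi\sqrt{-1}}{4}r}.$$ In particular, $$\sum_{\mu\in\mathcal M(\mathfrak g)}e^{\pi\sqrt{-1}\,(\mu|\mu)}=\sqrt{|Z(\tilde G)|}\;e^{\frac{\pi\sqrt{-1}}{4}r}.$$
   Context: Simply laced means that all roots have the same length. Let $T$ be a maximal torus of $G$ with Lie algebra $\mathfrak t$, $\Delta\subset\sqrt{-1}\,\mathfrak t^*$ the root system, and $(\cdot|\cdot)$ the Weyl group invariant inner product on $\sqrt{-1}\,\mathfrak t^*$ with $(\alpha|\alpha)=2$ for all $\alpha\in\Delta$. For $\alpha\in\Delta$ the coroot $\check\alpha\in\sqrt{-1}\,\mathfrak t$ is given by $\langle\beta,\check\alpha\rangle=2(\beta|\alpha)/(\alpha|\alpha)$ for all $\beta\in\Delta$. Put $\check\Delta=\{\check\alpha\mid\alpha\in\Delta\}$, $\Lambda=\mathrm{span}_{\mathbb Z}\Delta$ (root lattice), $\check\Lambda=\mathrm{span}_{\mathbb Z}\check\Delta$ (coroot lattice), with dual lattices $\check\Lambda^*\subset\sqrt{-1}\,\mathfrak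 t^*$ (weight lattice) and $\Lambda^*\subset\sqrt{-1}\,\mathfrak t$ (coweight lattice). Let $\ell\subset\sqrt{-1}\,\mathfrak t$ be the lattice such that $T=\mathfrak t/2\pi\sqrt{-1}\,\ell$; then $\check\Lambda\subset\ell\subset\Lambda^*$, the centre of $G$ is $Z(G)=\Lambda^*/\ell$, $\pi_1(G)=\ell/\check\Lambda$, and $Z(\tilde G)\cong\Lambda^*/\check\Lambda$. Langlands dual: ${}^L\mathfrak g$ is the simple (compact) Lie algebra with root system $\check\Delta$; $\widetilde{{}^LG}$ is the simply connected compact group with Lie algebra ${}^L\mathfrak g$, whose centre is $Z(\widetilde{{}^LG})\cong\check\Lambda^*/\Lambda\cong Z(\tilde G)^*=\mathrm{Hom}(Z(\tilde G),U(1))$; and ${}^LG=\widetilde{{}^LG}/\pi_1({}^LG)$ with $\pi_1({}^LG)=\{\chi\in Z(\tilde G)^*\mid\chi(\pi_1(G))=1\}$, where $\pi_1(G)$ is regarded as a subgroup of $Z(\tilde G)$. Equivalently, the maximal torus of ${}^LG$ is $\mathfrak t^*/2\pi\sqrt{-1}\,\ell^*$, where $\ell^*$ is the dual lattice of $\ell$. For simply laced $\mathfrak g$, ${}^L\mathfrak g$ is also simply laced (of the same type), so $\mathcal G({}^LG)$ is defined by the same formula applied to ${}^LG$, using the inner product for which its roots have square length $2$. A non-trivial irreducible (complex, finite dimensional) representation of $\mathfrak g$ is miniscule if all its weights form a single Weyl group orbit; its highest weight (for a fixed choice of positive roots) is a miniscule weight. $\mathcal M(\mathfrak g)\subset\check\Lambda^*$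 is the set consisting of zero and the miniscule weights of $\mathfrak g$ (it contains exactly one element of each coset in $\check\Lambda^*/\Lambda$). $\mathcal M(G)\subset\mathcal M(\mathfrak g)$ is the set of highest weights of the trivial or miniscule representations of $G$, i.e. of those elements of $\mathcal M(\mathfrak g)$ that lie in $\ell^*$; in particular $\mathcal M(\tilde G)=\mathcal M(\mathfrak g)$. *)

(* Defs.v *)
From HB Require Import structures.
From mathcomp Require Import all_boot all_order all_algebra.
From mathcomp Require Import finmap complex.
From mathcomp Require Import all_classical all_reals all_analysis.

Set Implicit Arguments.
Unset Strict Implicit.
Unset Printing Implicit Defensive.

Import Order.TTheory GRing.Theory Num.Theory.
Local Open Scope classical_set_scope.
Local Open Scope ring_scope.
Local Open Scope complex_scope.

(* A compact connected Lie group G with semisimple Lie algebra is represented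
   by its root datum.  Fixing coordinates on the Lie algebra t of a maximal
   torus, row vectors are elements of sqrt(-1) t^*, column vectors are elements
   of sqrt(-1) t, and the duality pairing is the matrix product.  [lattice] is
   the lattice l such that the maximal torus is t / 2 pi sqrt(-1) l, and
   [gram] is the Gram matrix of the inner product on sqrt(-1) t^*. *)
Record group_datum (R : realType) (r : nat) := GroupDatum {
  root_seq : seq 'rV[R]_r;
  gram : 'M[R]_r;
  lattice : set 'cV[R]_r
}.

Definition pairing (R : realType) r (u : 'rV[R]_r) (x : 'cV[R]_r) : R :=
  (u *m x) ord0 ord0.

Section GroupDatum.
Variables (R : realType) (r : nat).
Implicit Types (G : group_datum R r) (u v : 'rV[R]_r) (x y : 'cV[R]_r).

Definition ip G u v : R := pairing u (gram G *m v^T).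

(* The element of sqrt(-1) t with <b, coroot a> = 2 (b|a) / (a|a). *)
Definition coroot G (a : 'rV[R]_r) : 'cV[R]_r :=
  (2 / ip G a a) *: (gram G *m a^T).

Definition reflection G (a u : 'rV[R]_r) : 'rV[R]_r :=
  u - pairing u (coroot G a) *: a.

Definition int_span (V : zmodType) (s : seq V) : set V :=
  [set v | inIntSpan (in_tuple s) v].

Definition root_lattice G : set 'rV[R]_r := int_span (root_seq G).

Definition coroot_lattice G : set 'cV[R]_r :=
  int_span [seq coroot G a | a <- root_seq G].

Definition dual_of_rows (L : set 'rV[R]_r) : set 'cV[R]_r :=
  [set x | forall u, L u -> pairing u x \is a Num.int].

Definition dual_of_cols (L : set 'cV[R]_r) : set 'rV[R]_r :=
  [set u | forall x, L x -> pairing u x \is a Num.int].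

Definition coweight_lattice G := dual_of_rows (root_lattice G).

Definition inner_product G : Prop :=
  (gram G)^T = gram G /\ (forall u, u != 0 -> 0 < ip G u u).

(* The form is automatically invariant under the Weyl group, because coroots,
   and hence reflections, are defined by means of it. *)
Definition root_system G : Prop :=
  [/\ forall u, u \in <<root_seq G>>%VS,
      0 \notin root_seq G,
      {in root_seq G &, forall a b, reflection G a b \in root_seq G},
      {in root_seq G &, forall a b, pairing b (coroot G a) \is a Num.int} &
      {in root_seq G, forall a (c : R), c *: a \in root_seq G -> c = 1 \/ c = -1}].

Definition irreducible_roots G : Prop :=
  root_seq G <> [::] /\
  forall P : pred 'rV[R]_r,
    (exists2 a, a \in root_seq G & P a) ->
    (exists2 b, b \in root_seq G & ~~ P b) ->
    exists a b, [/\ a \in root_seq G, b \in root_seq G, P a, ~~ P b & ip G a b != 0].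

Definition simply_laced G : Prop :=
  {in root_seq G &, forall a b, ip G a a = ip G b b}.

Definition normalized G : Prop := {in root_seq G, forall a, ip G a a = 2}.

Definition torus_lattice G : Prop :=
  [/\ lattice G 0,
      forall x y, lattice G x -> lattice G y -> lattice G (x - y),
      coroot_lattice G `<=` lattice G &
      lattice G `<=` coweight_lattice G].

Definition compact_simple_simply_laced G : Prop :=
  [/\ [/\ inner_product G, root_system G & irreducible_roots G],
      simply_laced G, normalized G & torus_lattice G].

(* The Langlands dual group has Cartan subalgebra t^*: its roots are the
   coroots of G, and its torus lattice is the dual of that of G.  The inverse
   Gram matrix is the dual inner product on sqrt(-1) t, for which coroots have
   square length 4 / (a|a), that is 2 for a normalized simply laced datum. *)
Definition langlands_dual G : group_datum R r :=
  GroupDatum [seq (coroot G a)^T | a <- root_seq G]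
             (invmx (gram G))
             [set x | dual_of_cols (lattice G) x^T].

Definition universal_cover G : group_datum R r :=
  GroupDatum (root_seq G) (gram G) (coroot_lattice G).

(* The cosets x + l, x in the coweight lattice, are the elements of
   Z(G) = coweight_lattice / l; [order_center] is their number. *)
Definition center_cosets G : set (set 'cV[R]_r) :=
  [set [set x + y | y in lattice G] | x in coweight_lattice G].

Definition order_center G : nat := #|` fset_set (center_cosets G)|%fset.

Definition simple_roots G (S : 'I_r -> 'rV[R]_r) : Prop :=
  [/\ forall i, S i \in root_seq G,
      row_free (\matrix_i S i) &
      {in root_seq G, forall a, exists c : 'I_r -> nat,
         a = \sum_i S i *+ c i \/ a = - \sum_i S i *+ c i}].

Definition weyl_orbit G (u : 'rV[R]_r) : set 'rV[R]_r :=
  [set v | exists2 s : seq 'rV[R]_r,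
     {subset s <= root_seq G} & v = foldr (reflection G) u s].

Section Representations.
Variables (G : group_datum R r) (S : 'I_r -> 'rV[R]_r) (V : vectType R[i]).
Implicit Types h e f : 'I_r -> 'End(V).

Definition bracket (x y : 'End(V)) : 'End(V) := (x \o y)%VF - (y \o x)%VF.

Definition cartan (i j : 'I_r) : R := pairing (S j) (coroot G (S i)).

(* Complex representations of the compact Lie algebra g on V are those of its
   complexification, which by Serre's theorem is presented by the Chevalley
   generators h_i (the simple coroots), e_i, f_i and the relations below.  The
   Serre exponent m is the integer 1 - a_ij >= 1. *)
Definition representation h e f : Prop :=
  [/\ forall i j, bracket (h i) (h j) = 0,
      forall i j, bracket (e i) (f j) = (if i == j then h i else 0),
      forall i j, bracket (h i) (e j) = (cartan i j)%:C *: e j /\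
                  bracket (h i) (f j) = - ((cartan i j)%:C *: f j) &
      forall i j (m : nat), i != j -> m%:R = 1 - cartan i j ->
        iter m (bracket (e i)) (e j) = 0 /\ iter m (bracket (f i)) (f j) = 0].

Definition invariant_subspace h e f (U : {vspace V}) : Prop :=
  forall i, [/\ (h i @: U <= U)%VS, (e i @: U <= U)%VS & (f i @: U <= U)%VS].

Definition irreducible_rep h e f : Prop :=
  (\dim {:V} != 0)%N /\
  (forall U : {vspace V}, invariant_subspace h e f U ->
     U = 0%VS \/ U = fullv).

Definition nontrivial_rep h e f : Prop :=
  exists i, [|| h i != 0, e i != 0 | f i != 0].

(* Weights are integral on coroots, so nothing is lost by regarding them as
   real functionals. *)
Definition weight_vector h (u : 'rV[R]_r) (v : V) : Prop :=
  forall i, h i v = (pairing u (coroot G (S i)))%:C *: v.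

Definition weights h : set 'rV[R]_r :=
  [set u | exists2 v : V, v != 0 & weight_vector h u v].

Definition highest_weight h e (u : 'rV[R]_r) : Prop :=
  exists v : V, [/\ v != 0, weight_vector h u v & forall i, e i v = 0].

Definition minuscule_rep h e f : Prop :=
  [/\ representation h e f, irreducible_rep h e f, nontrivial_rep h e f &
      exists u, weights h = weyl_orbit G u].

End Representations.

Definition minuscule_weight G (S : 'I_r -> 'rV[R]_r) (u : 'rV[R]_r) : Prop :=
  exists (V : vectType R[i]) (h e f : 'I_r -> 'End(V)),
    minuscule_rep G S h e f /\ highest_weight G S h e u.

Definition minuscule_algebra G (S : 'I_r -> 'rV[R]_r) : set 'rV[R]_r :=
  [set u | u = 0 \/ minuscule_weight G S u].

(* A weight of g belongs to a representation of G iff it lies in the dual of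
   the torus lattice. *)
Definition minuscule_group G (S : 'I_r -> 'rV[R]_r) : set 'rV[R]_r :=
  minuscule_algebra G S `&` dual_of_cols (lattice G).

Definition expi (t : R) : R[i] := cos t +i* sin t.

Definition gauss_sum G (S : 'I_r -> 'rV[R]_r) : R[i] :=
  (Num.sqrt (order_center G)%:R)%:C^-1 *
  \sum_(u \in minuscule_group G S) expi (pi * ip G u u).

End GroupDatum.

Lemma int_span_mem (V : zmodType) (s : seq V) x : x \in s -> int_span s x.
Proof.
move=> xs; have si : (index x s < size s)%N by rewrite index_mem.
exists [ffun j => (j == Ordinal si)%:Z].
rewrite (bigD1 (Ordinal si)) //= big1 ?addr0; last first.
  by move=> j /negbTE ji; rewrite ffunE ji.
by rewrite ffunE eqxx nth_index.
Qed.

Section DualDatum.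
Variables (R : realType) (r : nat) (G : group_datum R r).
Hypothesis hG : compact_simple_simply_laced G.

Let symG : (gram G)^T = gram G. Proof. by case: hG => -[[]]. Qed.

Let posG u : u != 0 -> 0 < ip G u u. Proof. by case: hG => -[[_ p] _ _] _ _ _; apply: p. Qed.

Let normG a : a \in root_seq G -> ip G a a = 2.
Proof. by case: hG => _ _ n _; apply: n. Qed.

Let unitG : gram G \in unitmx.
Proof.
rewrite -row_free_unit; apply/inj_row_free => v v0.
apply/eqP/negP => /negP /posG.
by rewrite /ip /pairing mulmxA v0 mul0mx mxE ltxx.
Qed.

Let corootE a : a \in root_seq G -> coroot G a = gram G *m a^T.
Proof. by move=> /normG aa; rewrite /coroot aa divff ?pnatr_eq0 // scale1r. Qed.

Let corootT a : a \in root_seq G -> (coroot G a)^T = a *m gram G.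
Proof. by move=> /corootE ->; rewrite trmx_mul trmxK symG. Qed.

Let ip_dual u v : ip (langlands_dual G) (u *m gram G) (v *m gram G) = ip G u v.
Proof.
by rewrite /ip /pairing /= trmx_mul symG -mulmxA (mulmxA (invmx _)) mulVmx // mul1mx.
Qed.

Let pairingZ (u : 'rV[R]_r) c x : pairing u (c *: x) = c * pairing u x.
Proof. by rewrite /pairing -scalemxAr mxE. Qed.

Let pairingT (u : 'rV[R]_r) (x : 'cV[R]_r) : pairing x^T u^T = pairing u x.
Proof. by rewrite /pairing -trmx_mul mxE. Qed.

Let coroot_dual u : ip G u u = 2 ->
  coroot (langlands_dual G) (u *m gram G) = u^T.
Proof.
move=> uu; rewrite /coroot ip_dual uu divff ?pnatr_eq0 // scale1r /=.
by rewrite trmx_mul symG mulKmx.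
Qed.

Let mem_dual b : b \in root_seq (langlands_dual G) ->
  exists2 a, a \in root_seq G & b = a *m gram G.
Proof. by move=> /= /mapP[a ain ->]; exists a => //; rewrite corootT. Qed.

Let in_dual a : a \in root_seq G -> a *m gram G \in root_seq (langlands_dual G).
Proof. by move=> ain; rewrite -corootT //; apply: map_f. Qed.

Let pairing_dual a b : a \in root_seq G ->
  pairing (b *m gram G) (coroot (langlands_dual G) (a *m gram G)) =
  pairing b (coroot G a).
Proof.
by move=> ain; rewrite coroot_dual ?normG // corootE // /pairing mulmxA.
Qed.

Lemma langlands_dual_valid : compact_simple_simply_laced (langlands_dual G).
Proof.
case: (hG) => -[_ [span r0 refl int red] [ne irr]] _ _ [l0 lB cl lc].
have injG u v : u *m gram G = v *m gram G -> u = v.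
  by move/(congr1 (mulmx^~ (invmx (gram G)))); rewrite !mulmxK.
split; first split.
- split; first by rewrite /= trmx_inv symG.
  by move=> u u0; rewrite -[u](mulmxKV unitG) ip_dual; apply: posG;
    apply: contraNneq u0 => u0; rewrite -[u](mulmxKV unitG) u0 mul0mx.
- split.
  + move=> u; rewrite -[u](mulmxKV unitG).
    have : u *m invmx (gram G) \in <<in_tuple (root_seq G)>>%VS by exact: span.
    move=> /coord_span ->.
    rewrite mulmx_suml; apply: memv_suml => i _.
    rewrite -scalemxAl; apply: memvZ; apply: memv_span; apply: in_dual.
    by rewrite mem_nth.
  + apply/negP => /mem_dual[a ain] /esym; rewrite -[X in _ = X](mul0mx _ (gram G)).
    by move/injG => a0; move: r0; rewrite -a0 ain.
  + move=> _ _ /mem_dual[a ain ->] /mem_dual[b bin ->].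
    rewrite /reflection pairing_dual // scalemxAl -mulmxBl; apply: in_dual.
    exact: refl.
  + move=> _ _ /mem_dual[a ain ->] /mem_dual[b bin ->].
    by rewrite pairing_dual //; apply: int.
  + move=> _ /mem_dual[a ain ->] c; rewrite scalemxAl => /mem_dual[b bin].
    by move/injG => cab; apply: (red a) => //; rewrite cab.
- split; first by move=> /= ; case: (root_seq G) ne.
  move=> P [_ /mem_dual[a ain ->] Pa] [_ /mem_dual[b bin ->] Pb].
  have [||c [d [cin din Pc Pd cd]]] := irr (fun a => P (a *m gram G)).
  + by exists a.
  + by exists b.
  by exists (c *m gram G), (d *m gram G); rewrite ip_dual !in_dual.
- move=> _ _ /mem_dual[a ain ->] /mem_dual[b bin ->].
  by rewrite !ip_dual !normG.
- by move=> _ /mem_dual[a ain ->]; rewrite ip_dual normG.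
split.
- by move=> x _; rewrite /pairing trmx0 mul0mx mxE.
- move=> x y lx ly z lz; rewrite /pairing linearB/= mulmxBl mxE [X in _ + X]mxE.
  by apply: rpredB; [apply: lx | apply: ly].
- move=> _ [c ->] y ly; rewrite /pairing linear_sum mulmx_suml summxE.
  apply: rpred_sum => i _; rewrite raddfMz/= -scaler_int -scalemxAl mxE.
  apply: rpredM; first exact: rpred_int.
  set x := _`_i; have : x \in [seq coroot (langlands_dual G) a | a <- root_seq (langlands_dual G)].
    by rewrite /x mem_nth.
  move=> /mapP[_ /mem_dual[a ain ->] ->].
  rewrite coroot_dual ?normG // trmxK; apply: (lc _ ly).
  exact: int_span_mem.
- move=> x lx _ [c ->]; rewrite /pairing mulmx_suml summxE.
  apply: rpred_sum => i _; rewrite -scaler_int -scalemxAl mxE.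
  apply: rpredM; first exact: rpred_int.
  set u := _`_i; have : u \in root_seq (langlands_dual G) by rewrite /u mem_nth.
  move=> /= /mapP[a ain ->]; rewrite -[X in _ *m X]trmxK -/(pairing _ _) pairingT.
  apply: lx; apply: cl.
  by apply: int_span_mem; apply: map_f.
Qed.

Lemma simple_roots_dual S : simple_roots G S ->
  simple_roots (langlands_dual G) (fun i => (coroot G (S i))^T).
Proof.
move=> [Sin Sfree Spos]; split=> [i||].
- exact: map_f.
- have -> : \matrix_i (coroot G (S i))^T = (\matrix_i S i) *m gram G.
    by apply/row_matrixP => i; rewrite row_mul !rowK corootT.
  by rewrite /row_free mxrankMfree // row_free_unit.
move=> _ /mem_dual[a ain ->]; have [c ac] := Spos a ain; exists c.
under eq_bigr do rewrite corootT // -scaler_nat scalemxAl scaler_nat.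
by rewrite -mulmx_suml -mulNmx; case: ac => <-; [left | right].
Qed.

End DualDatum.

(* Main.v *)
Require Import Defs.
From HB Require Import structures.
From mathcomp Require Import all_boot all_order all_algebra.
From mathcomp Require Import finmap complex.
From mathcomp Require Import all_classical all_reals all_analysis.
From mathcomp Require Import ring lra zify.

Set Implicit Arguments.
Unset Strict Implicit.
Unset Printing Implicit Defensive.

Import Order.TTheory GRing.Theory Num.Theory.
Local Open Scope classical_set_scope.
Local Open Scope ring_scope.
Local Open Scope complex_scope.

(** Write q(x) = exp (pi i (x|x)).  The root lattice Lambda is even, so q is
    constant on cosets of Lambda in the weight lattice W.  The elements of
    M(g) represent these cosets, hence the Gauss sums of G and of its Langlands
    dual are sums of q over subgroups of the finite group W / Lambda: over
    ell* / Lambda and over its orthogonal complement.  For a finite abelian group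
    with a quadratic function, character orthogonality relates the sum S_B over a
    subgroup B to the sum over the complement: S * conj S_B = |B| * S_(B^perp),
    where S is the sum over the whole group ([gauss_sum_perp]).  Both claims
    follow from this, provided that S has argument pi r / 4; all moduli come out
    of the counting identity |B| * |B^perp| = |A| * |A^perp| ([card_perp]).

    To find the argument of S, choose r mutually orthogonal vectors v_i in Lambda
    ([orthogonal_frame_exists]) and enlarge the group: all lattices of interest
    lie between the span of the v_i and the dual of that span, and the quotient of
    these two is a product of cyclic groups on which q is diagonal.  So the Gauss
    sum over it is a product of one-dimensional sums, over k mod a, of
    exp (pi i k^2 / a) with a = (v_i|v_i) even ([model_gauss_sum_arg]).  Enlarging
    the group costs nothing, because [gauss_sum_perp] allows degenerate pairings.
    The one-dimensional sum is rewritten, following Gauss, as a product of factors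
    1 + s^j by means of Gaussian binomial coefficients; each factor has an evident
    argument, and these add up to pi / 4 ([gauss_sum_arg]).

    It remains to see that M(g) represents the cosets.  First, M(g) consists of
    the dominant weights u with |(u|alpha)| <= 1 for all roots alpha
    ([minuscule_algebraE]).  All weights of a minuscule representation have the
    same length, which forces these bounds; conversely such a nonzero u is the
    highest weight of a representation on the functions on its Weyl orbit, in which
    the Chevalley generators act by shifts.  Second, each coset contains such a
    weight, found by subtracting roots as long as this shortens the vector and then
    reflecting ([coset_representative]), and only one, because a shortest expression
    of a lattice vector as a sum of n roots bounds its square length below by 2 n
    ([small_dominant_unique]). *)

(** * Arguments of complex numbers *)

Section Exponential.
Variable R : realType.
Implicit Types (s t : R) (z w : R[i]) (n : nat).

Lemma expi0 : expi (0 : R) = 1.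
Proof. by rewrite /expi cos0 sin0. Qed.

Lemma expiD s t : expi (s + t) = expi s * expi t.
Proof. by rewrite /expi cosD sinD; simpc; congr (_ +i* _); rewrite addrC. Qed.

Lemma conj_expi t : (expi t)^*%R = expi (- t).
Proof. by rewrite /expi cosN sinN. Qed.

Lemma expi_conjM t : expi t * (expi t)^* = 1.
Proof. by rewrite conj_expi -expiD subrr expi0. Qed.

Lemma expi_neq0 t : expi t != 0.
Proof.
by apply/eqP => t0; have /eqP := expi_conjM t; rewrite t0 mul0r eq_sym oner_eq0.
Qed.

Lemma expi_pi : expi (pi : R) = -1.
Proof. by rewrite /expi cospi sinpi; simpc. Qed.

Lemma expi_pihalf : expi (pi / 2 : R) = 'i%C.
Proof. by rewrite /expi cos_pihalf sin_pihalf. Qed.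

Lemma expiX t n : expi (n%:R * t) = expi t ^+ n.
Proof.
elim: n => [|n IH]; first by rewrite mul0r expi0.
by rewrite -natr1 mulrDl mul1r expiD IH exprSr.
Qed.

Lemma expi_2pi_int (x : R) : x \is a Num.int -> expi (2 * pi * x) = 1.
Proof.
have p2 n : expi (2 * pi * n%:R : R) = 1.
  have -> : 2 * pi * n%:R = n%:R * (pi + pi) :> R by ring.
  by rewrite expiX expiD expi_pi mulrNN mulr1 expr1n.
move=> /intrP[[n|n] ->]; first exact: p2.
by rewrite NegzE mulrNz mulrN -conj_expi p2 rmorph1.
Qed.

Lemma expi_pi_even (x y : R) : x \is a Num.int -> y = 2 * x -> expi (pi * y) = 1.
Proof. by move=> xint ->; rewrite mulrCA mulrA expi_2pi_int. Qed.

Lemma expi_double_neq1 t : 0 < t < pi -> expi (t + t) != 1.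
Proof.
move=> /sin_gt0_pi sin_t; rewrite /expi eq_complex /= negb_and; apply/orP; left.
have -> : t + t = t *+ 2 by rewrite mulr2n.
rewrite cos_mulr2n; apply/eqP.
by have := cos2Dsin2 t; have : 0 < sin t ^+ 2 by [rewrite exprn_gt0]; lra.
Qed.

Lemma expi_2pi_eq1 (x : R) : expi (2 * pi * x) = 1 -> x \is a Num.int.
Proof.
have /andP[fx xf] := floor_itv x; set m : R := (Num.floor x)%:~R in fx.
have m_int : m \is a Num.int by rewrite intr_int.
rewrite -[x in 2 * pi * x](subrK m) mulrDr expiD (expi_2pi_int m_int) mulr1 => x1.
suff -> : x = m by [].
apply: contraPeq x1 => xm; apply/eqP.
have -> : 2 * pi * (x - m) = pi * (x - m) + pi * (x - m) :> R by ring.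
have xm_gt0 : 0 < x - m by rewrite subr_gt0 lt_neqAle eq_sym xm.
apply: expi_double_neq1; rewrite mulr_gt0 ?pi_gt0 //= gtr_pMr ?pi_gt0 //.
by move: xf; rewrite intrD -/m; lra.
Qed.

(** Only arguments have to be tracked through the evaluation of a Gauss sum, since
    its modulus follows from character orthogonality. *)
Definition has_arg z t := exists2 c : R, 0 < c & z = c%:C * expi t.

Lemma has_argM z w s t : has_arg z s -> has_arg w t -> has_arg (z * w) (s + t).
Proof.
move=> [c c0 ->] [d d0 ->]; exists (c * d); first exact: mulr_gt0.
by rewrite expiD rmorphM /= mulrACA.
Qed.

Lemma has_arg_prod (I : Type) (r : seq I) (P : pred I) (F : I -> R[i]) (t : I -> R) :
  (forall i, P i -> has_arg (F i) (t i)) ->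
  has_arg (\prod_(i <- r | P i) F i) (\sum_(i <- r | P i) t i).
Proof.
move=> Ft; apply: (big_rec2 has_arg) => [|i s z Pi zs].
  by exists 1 => //; rewrite expi0 mulr1.
by apply: has_argM => //; apply: Ft.
Qed.

End Exponential.

(** * Gaussian binomial coefficients *)

Section GaussPolynomials.
Variables (F : fieldType) (q : F).

Definition qfact n : F := \prod_(1 <= i < n.+1) (1 - q ^+ i).

(** The Gaussian binomial coefficient, as long as [n] is smaller than the order
    of [q]; beyond that the quotient degenerates to a division by [0]. *)
Definition qbinom n k : F := qfact n / (qfact k * qfact (n - k)).

Lemma qfactS n : qfact n.+1 = qfact n * (1 - q ^+ n.+1).
Proof. by rewrite /qfact big_nat_recr. Qed.

Lemma qfact_neq0 a n :
  (forall i, (0 < i < a)%N -> q ^+ i != 1) -> (n < a)%N -> qfact n != 0.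
Proof.
move=> qa; elim: n => [|n IH] na; first by rewrite /qfact big_geq ?oner_eq0.
rewrite qfactS mulf_neq0 ?IH 1?ltnW // subr_eq0 eq_sym; apply: qa.
by rewrite na.
Qed.

Lemma qbinom_sub n k : (k <= n)%N -> qbinom n (n - k) = qbinom n k.
Proof. by move=> kn; rewrite /qbinom subKn // (mulrC (qfact k)). Qed.

Variable a : nat.
Hypothesis q_order : forall i, (0 < i < a)%N -> q ^+ i != 1.

Let qf0 n : (n < a)%N -> qfact n != 0.
Proof. exact: (qfact_neq0 q_order). Qed.

Lemma qbinom0 n : (n < a)%N -> qbinom n 0 = 1.
Proof. by move=> na; rewrite /qbinom subn0 {2}/qfact big_geq // mul1r divff ?qf0. Qed.

Lemma qbinomn n : (n < a)%N -> qbinom n n = 1.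
Proof. by move=> na; rewrite -[RHS](qbinom0 na) -(qbinom_sub (leq0n n)) subn0. Qed.

Lemma qbinomS n k : (n.+1 < a)%N -> (k < n)%N ->
  qbinom n.+1 k.+1 = qbinom n k.+1 + q ^+ (n - k) * qbinom n k.
Proof.
move=> na kn; rewrite /qbinom subSS.
have -> : (n - k = (n - k.+1).+1)%N by rewrite subnSK.
set l := (n - k.+1)%N.
rewrite !qfactS.
have f1 := @qf0 k.+1 ltac:(lia); have f2 := @qf0 l.+1 ltac:(lia).
rewrite !qfactS in f1 f2.
have -> : q ^+ n.+1 = q ^+ l.+1 * q ^+ k.+1 by rewrite -exprD; congr (_ ^+ _); lia.
move: f1 f2; rewrite !mulf_eq0 !negb_or => /andP[k0 k1] /andP[l0 l1].
by field; rewrite k0 k1 l0 l1.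
Qed.

(** At a root of unity of order [n.+1] this determines all the coefficients of [n],
    because [q ^+ (n - k)] is then the inverse of [q ^+ k.+1]. *)
Lemma qbinom_ratio n k : (n < a)%N -> (k < n)%N ->
  (1 - q ^+ k.+1) * qbinom n k.+1 = (1 - q ^+ (n - k)) * qbinom n k.
Proof.
move=> na kn; rewrite /qbinom.
have -> : (n - k = (n - k.+1).+1)%N by rewrite subnSK.
set l := (n - k.+1)%N; rewrite !qfactS.
have f1 := @qf0 k.+1 ltac:(lia); have f2 := @qf0 l.+1 ltac:(lia).
rewrite !qfactS in f1 f2.
move: f1 f2; rewrite !mulf_eq0 !negb_or => /andP[k0 k1] /andP[l0 l1].
by field; rewrite k0 k1 l0 l1.
Qed.

(** Gauss's evaluation of the Rogers-Szego polynomial at a square root of [q]: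
    in Pascal's rule the two terms are exchanged by the symmetry of the
    coefficients, up to the factor [s ^+ n.+1]. *)
Lemma gauss_polynomial s n : s ^+ 2 = q -> (n < a)%N ->
  \sum_(0 <= j < n.+1) s ^+ j * qbinom n j = \prod_(1 <= j < n.+1) (1 + s ^+ j).
Proof.
move=> sq; elim: n => [|n IH] na.
  by rewrite big_nat1 big_geq // qbinom0 // mulr1.
rewrite [RHS]big_nat_recr //= -IH; last exact: ltnW.
have -> : \sum_(0 <= j < n.+2) s ^+ j * qbinom n.+1 j =
    \sum_(0 <= j < n.+1) s ^+ j * qbinom n j +
    \sum_(0 <= j < n.+1) s ^+ n.+1 * (s ^+ (n - j) * qbinom n j).
  rewrite big_nat_recl // big_nat_recr //= qbinom0 // qbinomn //.
  rewrite [in X in _ = X + _]big_nat_recl // [in X in _ = _ + X]big_nat_recr //=.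
  rewrite qbinom0 1?ltnW // qbinomn 1?ltnW // subnn !mulr1 !addrA; congr (_ + _).
  rewrite -addrA; congr (_ + _); rewrite -big_split /=.
  apply: eq_big_nat => j /andP[_ jn].
  rewrite qbinomS // mulrDr !mulrA -sq -exprM -!exprD.
  by have -> : (j.+1 + 2 * (n - j) = n.+1 + (n - j))%N by lia.
rewrite mulrDr mulr1 -big_distrr /= mulrC; congr (_ + _ * _).
rewrite big_nat_rev /=; apply: eq_big_nat => j /andP[_ jn].
by rewrite add0n subSS qbinom_sub // subKn.
Qed.

End GaussPolynomials.

(** * The one-dimensional quadratic Gauss sum *)

Section QuadraticGaussSum.
Variable R : realType.

(** The argument of the Gauss sum of the lattice spanned by one vector of square
    length [a].  With [s = - expi (- pi / a)], the Gauss polynomial of degree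
    [a - 1] at [s] has the quadratic exponentials as its terms, and each factor
    [1 + s ^+ j] has a visible argument. *)
Lemma gauss_sum_arg (a : nat) : (0 < a)%N -> ~~ odd a ->
  has_arg (\sum_(0 <= k < a) expi (pi * (k%:R ^+ 2 / a%:R) : R)) (pi / 4).
Proof.
move=> a0 aev; have aR : a%:R != 0 :> R by rewrite pnatr_eq0 -lt0n.
have pi0 : 0 < (pi : R) := pi_gt0 R.
pose s : R[i] := - expi (- (pi / a%:R)).
have s_pow j : s ^+ j = expi ((odd j)%:R * pi - j%:R * (pi / a%:R)).
  by rewrite /s exprNn expiD -(mulrN j%:R) !expiX expi_pi signr_odd.
have q_order i : (0 < i < a)%N -> (s ^+ 2) ^+ i != 1.
  move=> /andP[i0 ia]; rewrite -exprM s_pow oddM /= mul0r sub0r.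
  set t : R := pi * (i%:R / a%:R).
  have -> : - ((2 * i)%:R * (pi / a%:R)) = - t - t :> R.
    by rewrite /t natrM; field.
  have tpi : 0 < t < pi.
    rewrite /t mulr_gt0 ?divr_gt0 ?ltr0n //= gtr_pMr //.
    by rewrite ltr_pdivrMr ?ltr0n // mul1r ltr_nat.
  by rewrite -opprD -conj_expi fmorph_eq1 expi_double_neq1.
have q1 (i : nat) : (0 < i < a)%N -> 1 - (s ^+ 2) ^+ i != 0.
  by move=> /q_order; rewrite subr_eq0 eq_sym.
have qE (i : nat) : (s ^+ 2) ^+ i = expi (- (2 * i%:R * (pi / a%:R))).
  by rewrite -exprM s_pow oddM /= mul0r sub0r natrM.
(* [q ^+ a = 1] turns the ratio of consecutive coefficients into
   [- q ^- j.+1], so they are quadratic exponentials up to sign. *)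
have term j : (j < a)%N ->
    s ^+ j * qbinom (s ^+ 2) a.-1 j = expi (pi * (j%:R ^+ 2 / a%:R)).
  elim: j => [|j IH] ja.
    by rewrite (qbinom0 q_order) ?prednK // !mulr1 expr0n /= mul0r mulr0 expi0.
  have {}IH := IH (ltnW ja).
  have qj : (s ^+ 2) ^+ j.+1 != 0 by rewrite qE expi_neq0.
  have rec : (s ^+ 2) ^+ j.+1 * qbinom (s ^+ 2) a.-1 j.+1 =
             - qbinom (s ^+ 2) a.-1 j.
    have ratio := @qbinom_ratio _ _ a q_order a.-1 j ltac:(lia) ltac:(lia).
    have qa : (s ^+ 2) ^+ j.+1 * (s ^+ 2) ^+ (a.-1 - j) = 1.
      rewrite -exprD qE; have -> : (j.+1 + (a.-1 - j) = a)%N by lia.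
      have -> : - (2 * a%:R * (pi / a%:R)) = - (pi + pi) :> R by field.
      by rewrite opprD expiD -conj_expi expi_pi rmorphN1 mulrNN mulr1.
    apply: (mulfI (q1 j.+1 _)); first by rewrite ja.
    rewrite mulrCA ratio mulrA mulrBr mulr1 qa; ring.
  apply: (mulfI qj); rewrite mulrCA rec exprS mulrN -mulrA IH -mulNr opprK.
  rewrite qE -!expiD; congr expi; rewrite -natr1; field; exact: aR.
have -> : \sum_(0 <= k < a) expi (pi * (k%:R ^+ 2 / a%:R)) =
    \prod_(1 <= j < a) (1 + s ^+ j).
  rewrite -[in RHS](prednK a0) -(gauss_polynomial q_order) ?prednK //.
  by apply: eq_big_nat => j /andP[_ /term ->].
(* With [t = pi j / (2 a)], the factor [1 + s ^+ j] is [2 cos t * expi (- t)] for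
   even [j] and [2 sin t * expi (pi / 2 - t)] for odd [j]. *)
have -> : pi / 4 = \sum_(1 <= j < a)
    ((odd j)%:R * (pi / 2) - j%:R * (pi / (2 * a%:R))) :> R.
  have [m am] : exists m, a = m.*2.+2.
    by exists (a.-2)./2; move: a0 aev; lia.
  have sumE A B : \sum_(1 <= j < m.*2.+2) ((odd j)%:R * A - j%:R * B) =
      m.+1%:R * A - m.+1%:R * (2 * m%:R + 1) * B :> R.
    elim: m {am} => [|m IH]; first by rewrite big_nat1 /=; ring.
    rewrite doubleS big_nat_recr //= big_nat_recr //= IH /= odd_double /=.
    by rewrite -!natr1 -!mul2n natrM; ring.
  rewrite {1}am sumE am -!natr1 -mul2n natrM; field.
  by rewrite -natrM !natr1 pnatr_eq0.
rewrite [X in has_arg X _]big_seq [X in has_arg _ X]big_seq.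
apply: has_arg_prod => j; rewrite mem_index_iota => /andP[j0 ja].
have -> : j%:R * (pi / (2 * a%:R)) = pi / 2 * (j%:R / a%:R) :> R by field.
set t : R := pi / 2 * (j%:R / a%:R).
have tpi : 0 < t < pi / 2.
  rewrite /t mulr_gt0 ?divr_gt0 ?ltr0n //= gtr_pMr ?divr_gt0 //.
  by rewrite ltr_pdivrMr ?ltr0n // mul1r ltr_nat.
have e1 : 1 = expi t * expi (- t) :> R[i] by rewrite -expiD subrr expi0.
have tj : j%:R * (pi / a%:R) = t + t by rewrite /t; field.
rewrite s_pow tj {tj}; case: (odd j); rewrite ?mulr1n ?mulr0n ?mul1r ?mul0r ?sub0r.
  exists (2 * sin t).
    by rewrite mulr_gt0 // sin_gt0_pihalf.
  rewrite opprD (expiD pi) (expiD (pi / 2)) (expiD (- t)) expi_pi expi_pihalf mulN1r {1}e1 -mulrBl.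
  by rewrite /expi cosN sinN; simpc; congr (_ +i* _); ring.
exists (2 * cos t).
  rewrite mulr_gt0 // cos_gt0_pihalf //; case/andP: tpi => t0 ->.
  by rewrite andbT; apply: lt_trans t0; rewrite oppr_lt0 divr_gt0.
rewrite opprD !expiD {1}e1 -mulrDl; congr (_ * _).
by rewrite /expi cosN sinN; simpc; congr (_ +i* _); ring.
Qed.

(** The summand has period [c], because [c] is even. *)
Lemma gauss_sum_periods_arg (c m : nat) : (0 < c)%N -> ~~ odd c -> (0 < m)%N ->
  has_arg (\sum_(0 <= k < c * m) expi (pi * (k%:R ^+ 2 / c%:R) : R)) (pi / 4).
Proof.
move=> c0 cev m0; have cR : c%:R != 0 :> R by rewrite pnatr_eq0 -lt0n.
pose f (k : nat) : R[i] := expi (pi * (k%:R ^+ 2 / c%:R)).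
have f_period k p : f (k + c * p)%N = f k.
  rewrite /f natrD natrM.
  have -> : pi * ((k%:R + c%:R * p%:R) ^+ 2 / c%:R) =
     pi * (k%:R ^+ 2 / c%:R) + 2 * pi * (k%:R * p%:R + (c./2 * p ^ 2)%:R) :> R.
    rewrite natrM natrX; have cE : c%:R = 2 * (c./2)%:R :> R.
      by rewrite -natrM mul2n even_halfK.
    have h0 : (c./2)%:R != 0 :> R by move: cR; rewrite cE mulf_eq0 negb_or => /andP[].
    by rewrite cE; field.
  by rewrite expiD expi_2pi_int ?mulr1 // rpredD ?rpredM ?rpred_nat.
have -> : \sum_(0 <= k < c * m) f k = m%:R * \sum_(0 <= k < c) f k.
  elim: m {m0} => [|m IH]; first by rewrite muln0 big_geq // mul0r.
  rewrite mulnS addnC (big_cat_nat _ (n := (c * m)%N)) //=; last exact: leq_addr.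
  rewrite IH -natr1 mulrDl mul1r; congr (_ + _).
  rewrite -{1}[(c * m)%N]add0n big_addn addKn.
  by apply: eq_bigr => k _; rewrite f_period.
have [d d0 ->] := gauss_sum_arg c0 cev; exists (m%:R * d).
  by rewrite mulr_gt0 // ltr0n.
by rewrite rmorphM rmorph_nat mulrA.
Qed.

End QuadraticGaussSum.

(** * Gauss sums on finite abelian groups *)

Section FiniteQuadraticForm.
Variables (R : realType) (A : finZmodType) (q : A -> R[i]) (b : A -> A -> R[i]).
Hypothesis qD : forall x y, q (x + y) = q x * q y * b x y.
Hypothesis q_unit : forall x, q x * (q x)^*%R = 1.
Hypothesis bC : forall x y, b x y = b y x.
Hypothesis bD : forall x y z, b x (y + z) = b x y * b x z.
Implicit Types (B : {set A}) (x y : A).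

Definition subgroup B := (0 \in B) /\ {in B &, forall x y, x - y \in B}.

(** The pairing may be degenerate: [perp [set: A]] is its kernel. *)
Definition perp B : {set A} := [set x | [forall y in B, b x y == 1]].

Lemma perpP B x : reflect (forall y, y \in B -> b x y = 1) (x \in perp B).
Proof. by rewrite inE; apply: (iffP forall_inP) => h y yB; apply/eqP/h. Qed.

Lemma subgroup_setT : subgroup [set: A]%SET.
Proof. by split=> [|x y _ _]; rewrite inE. Qed.

Lemma subgroupD B x y : subgroup B -> x \in B -> y \in B -> x + y \in B.
Proof.
move=> [B0 BB] xB yB; rewrite -[y]opprK; apply: (BB) => //.
by rewrite -[- y]add0r; apply: BB.
Qed.

Lemma reindex_subgroup B y (F : A -> R[i]) : subgroup B -> y \in B ->
  \sum_(x in B) F x = \sum_(x in B) F (x + y).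
Proof.
move=> sB yB; rewrite (reindex_onto (fun x => x + y) (fun x => x - y)) /=; last first.
  by move=> x _; rewrite subrK.
apply: eq_bigl => x; rewrite addrK eqxx andbT.
apply/idP/idP => [xyB|xB]; last exact: subgroupD.
by rewrite -(addrK y x); apply: sB.2.
Qed.

(** If some value of the character differs from [1], translating the sum by that
    element multiplies it by the value. *)
Lemma sum_character B x : subgroup B ->
  \sum_(y in B) b x y = if x \in perp B then #|B|%:R else 0.
Proof.
move=> sB; case: ifPn => [/perpP xB|/perpP xB].
  by rewrite (eq_bigr _ xB) sumr_const.
have [y yB bxy] : exists2 y, y \in B & b x y != 1.
  apply: contrapT => h; apply: xB => y yB; apply: contrapT => /eqP bxy.
  by apply: h; exists y.
have := reindex_subgroup (b x) sB yB.
under [X in _ = X -> _]eq_bigr do rewrite bD.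
rewrite -mulr_suml => /eqP; rewrite -subr_eq0 -{1}[\sum_(_ in _) _]mulr1 -mulrBr.
by rewrite mulf_eq0 subr_eq0 [1 == _]eq_sym (negbTE bxy) orbF => /eqP.
Qed.

(** After the change of variable [x := x + y], the summand [q (x + y) * (q y)^*]
    is [q x * b x y], so the product is a sum of characters of [B] weighted by
    [q]. *)
Lemma gauss_sum_perp B : subgroup B ->
  (\sum_x q x) * (\sum_(x in B) q x)^*%R = #|B|%:R * \sum_(x in perp B) q x.
Proof.
move=> sB; rewrite rmorph_sum /= mulr_sumr.
transitivity (\sum_(y in B) \sum_x q x * b x y).
  apply: eq_bigr => y _; rewrite mulr_suml.
  rewrite (reindex_inj (addIr y)) /=; apply: eq_bigr => x _.
  by rewrite qD mulrAC -[q x * q y * _]mulrA q_unit mulr1.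
rewrite exchange_big /= mulr_sumr big_mkcond [RHS]big_mkcond /=.
apply: eq_bigr => x _; rewrite -mulr_sumr sum_character //.
by case: ifP; rewrite ?mulr0 // mulrC.
Qed.

(** Both sides evaluate the sum of the pairing over the product of [A] and [B],
    one in each order of summation. *)
Lemma card_perp B : subgroup B -> perp [set: A]%SET \subset B ->
  (#|B| * #|perp B| = #|A| * #|perp [set: A]%SET|)%N.
Proof.
move=> sB AB; apply/eqP; rewrite -(eqr_nat R[i]) !natrM; apply/eqP.
have cardE (C D : {set A}) : subgroup C -> perp C \subset D ->
    \sum_(x in D) \sum_(y in C) b x y = #|C|%:R * #|perp C|%:R.
  move=> sC CD; under eq_bigr do rewrite sum_character //.
  rewrite -big_mkcondr /= mulr_natr -[RHS]sumr_const; apply: eq_bigl => x.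
  by rewrite andb_idl // => /(fintype.subsetP CD).
rewrite -[LHS](cardE _ [set: A]%SET) ?subsetT // exchange_big /=.
have -> : #|A| = #|[set: A]%SET| by rewrite cardsT.
rewrite -(cardE [set: A]%SET B) //; last exact: subgroup_setT.
by apply: eq_bigr => x _; apply: eq_bigr => y _; rewrite bC.
Qed.

End FiniteQuadraticForm.

(** * Integer spans and integral reals *)

Section IntegerSpan.
Variables (V : zmodType) (s : seq V).

Lemma int_span0 : int_span s 0.
Proof. by exists [ffun=> 0]; rewrite big1 // => i _; rewrite ffunE mulr0z. Qed.

Lemma int_spanB x y : int_span s x -> int_span s y -> int_span s (x - y).
Proof.
move=> [c ->] [d ->]; exists [ffun i => c i - d i].
by rewrite -sumrB; apply: eq_bigr => i _; rewrite ffunE mulrzBr.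
Qed.

Lemma int_spanN x : int_span s x -> int_span s (- x).
Proof. by move=> xs; rewrite -[- x]add0r; apply: int_spanB => //; apply: int_span0. Qed.

Lemma int_spanD x y : int_span s x -> int_span s y -> int_span s (x + y).
Proof. by move=> xs /int_spanN ys; rewrite -[y]opprK; apply: int_spanB. Qed.

Lemma int_span_sum (I : Type) (e : seq I) (P : pred I) (F : I -> V) :
  (forall i, P i -> int_span s (F i)) -> int_span s (\sum_(i <- e | P i) F i).
Proof. by move=> sF; apply: big_ind => //; [exact: int_span0 | exact: int_spanD]. Qed.

Lemma int_spanMz x (n : int) : int_span s x -> int_span s (x *~ n).
Proof.
move=> xs; have xM (m : nat) : int_span s (x *+ m).
  elim: m => [|m IH]; first exact: int_span0.
  by rewrite mulrS; apply: int_spanD.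
by case: n => m; rewrite ?NegzE ?mulrNz; [|apply: int_spanN]; apply: xM.
Qed.

(** A property of the generators that is stable under subtraction holds on the
    whole span; integer coefficients need not be handled afterwards. *)
Lemma int_span_ind (P : V -> Prop) : P 0 ->
  (forall x y, P x -> P y -> P (x - y)) -> {in s, forall x, P x} ->
  forall x, int_span s x -> P x.
Proof.
move=> P0 PB Ps _ [c ->].
have PN x : P x -> P (- x) by move=> Px; rewrite -[- x]add0r; apply: PB.
have PD x y : P x -> P y -> P (x + y).
  by move=> Px /PN Py; rewrite -[y]opprK; apply: PB.
have PM x n : P x -> P (x *+ n).
  by move=> Px; elim: n => // n IH; rewrite mulrS; apply: PD.
apply: big_ind => // i _; have Pi : P s`_i by apply: Ps; rewrite mem_nth.
by case: (c i) => n; rewrite ?NegzE ?mulrNz; [|apply: PN]; apply: PM.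
Qed.

End IntegerSpan.

Lemma int_span_map (V W : zmodType) (f : {additive V -> W}) (s : seq V) x :
  int_span s x -> int_span [seq f u | u <- s] (f x).
Proof.
move: x; apply: int_span_ind => [|x y fx fy|x xs]; rewrite ?raddf0 ?raddfB.
- exact: int_span0.
- exact: int_spanB.
- by apply: int_span_mem; apply: map_f.
Qed.

Section IntegralReals.
Variable R : realType.
Implicit Types x y : R.

Lemma int_num_ltD1 x y : x \is a Num.int -> y \is a Num.int -> x < y -> x + 1 <= y.
Proof.
move=> /intrP[m ->] /intrP[n ->]; rewrite ltr_int => mn.
by rewrite -[1 in X in X <= _]/(1%:~R) -intrD ler_int lezD1.
Qed.

Lemma int_num_abs_le1 x : x \is a Num.int -> `|x| <= 1 -> [\/ x = -1, x = 0 | x = 1].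
Proof.
move=> /intrP[m ->]; rewrite -intr_norm -[1 in X in _ <= X]/(1%:~R) ler_int => m1.
have [->|[->|->]] : m = -1 \/ m = 0 \/ m = 1 by lia.
- by constructor 1; rewrite mulrN1z.
- by constructor 2.
- by constructor 3.
Qed.

Lemma trunc_ltn x y : 0 <= x -> x + 1 <= y -> (Num.truncn x < Num.truncn y)%N.
Proof.
move=> x0 xy; rewrite truncn_gt_nat -natr1; apply: le_trans xy.
by rewrite lerD2r truncn_le.
Qed.

End IntegralReals.

(** * Simply laced root systems *)

Section RootSystem.
Variables (R : realType) (r : nat) (G : group_datum R r).
Hypothesis hG : compact_simple_simply_laced G.
Implicit Types (u v w a : 'rV[R]_r).

Local Notation Phi := (root_seq G).
Local Notation "''[' u , v ]" := (ip G u v).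

Lemma gram_sym : (gram G)^T = gram G. Proof. by case: hG => -[[]]. Qed.

Lemma ip_gt0 u : u != 0 -> 0 < '[u, u].
Proof. by case: hG => -[[_ p] _ _] _ _ _; apply: p. Qed.

Lemma ipC u v : '[u, v] = '[v, u].
Proof.
rewrite /ip /pairing -[in LHS](trmxK (u *m _)) mxE.
by rewrite !trmx_mul trmxK gram_sym mulmxA.
Qed.

Lemma ipDl u v w : '[u + v, w] = '[u, w] + '[v, w].
Proof. by rewrite /ip /pairing mulmxDl mxE. Qed.

Lemma ipZl c u v : '[c *: u, v] = c * '[u, v].
Proof. by rewrite /ip /pairing -scalemxAl mxE. Qed.

Lemma ip0l u : '[0, u] = 0.
Proof. by rewrite -(scale0r 0) ipZl mul0r. Qed.

Lemma ipNl u v : '[- u, v] = - '[u, v].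
Proof. by rewrite -scaleN1r ipZl mulN1r. Qed.

Lemma ipBl u v w : '[u - v, w] = '[u, w] - '[v, w].
Proof. by rewrite ipDl ipNl. Qed.

Lemma ip_suml (I : Type) (e : seq I) (P : pred I) (F : I -> 'rV[R]_r) u :
  '[\sum_(i <- e | P i) F i, u] = \sum_(i <- e | P i) '[F i, u].
Proof.
apply: (big_morph (fun v => '[v, u])) => [v w|]; [exact: ipDl | exact: ip0l].
Qed.

Lemma ipDr u v w : '[u, v + w] = '[u, v] + '[u, w].
Proof. by rewrite ipC ipDl !(ipC _ u). Qed.

Lemma ipZr c u v : '[u, c *: v] = c * '[u, v].
Proof. by rewrite ipC ipZl ipC. Qed.

Lemma ip0r u : '[u, 0] = 0. Proof. by rewrite ipC ip0l. Qed.

Lemma ipNr u v : '[u, - v] = - '[u, v].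
Proof. by rewrite ipC ipNl ipC. Qed.

Lemma ipBr u v w : '[u, v - w] = '[u, v] - '[u, w].
Proof. by rewrite ipDr ipNr. Qed.

Lemma ip_sumr (I : Type) (e : seq I) (P : pred I) (F : I -> 'rV[R]_r) u :
  '[u, \sum_(i <- e | P i) F i] = \sum_(i <- e | P i) '[u, F i].
Proof. by rewrite ipC ip_suml; apply: eq_bigr => i _; rewrite ipC. Qed.

Lemma ip_le0 u : '[u, u] <= 0 -> u = 0.
Proof. by move=> u0; apply: contraTeq u0 => /ip_gt0; rewrite -ltNge. Qed.

Lemma ip_ge0 u : 0 <= '[u, u].
Proof. by have [->|/ip_gt0/ltW //] := eqVneq u 0; rewrite ip0l. Qed.

Lemma root_norm a : a \in Phi -> '[a, a] = 2.
Proof. by case: hG => _ _ n _; apply: n. Qed.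

Lemma pairing_coroot u a : a \in Phi -> pairing u (coroot G a) = '[u, a].
Proof. by move=> /root_norm aa; rewrite /coroot aa divff ?pnatr_eq0 // scale1r. Qed.

Lemma reflectionE u a : a \in Phi -> reflection G a u = u - '[u, a] *: a.
Proof. by move=> aP; rewrite /reflection pairing_coroot. Qed.

Lemma root_reflection a b : a \in Phi -> b \in Phi -> reflection G a b \in Phi.
Proof. by case: hG => -[_ [_ _ h _ _] _] _ _ _; apply: h. Qed.

Lemma root_ip_int a b : a \in Phi -> b \in Phi -> '[a, b] \is a Num.int.
Proof.
case: hG => -[_ [_ _ _ h _] _] _ _ _ aP bP.
by rewrite -pairing_coroot //; apply: h.
Qed.

Lemma root_span u : u \in <<Phi>>%VS.
Proof. by case: hG => -[_ [h _ _ _ _] _] _ _ _; apply: h. Qed.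

Lemma root_neq0 a : a \in Phi -> a != 0.
Proof.
by move=> /root_norm aa; apply/eqP => a0; move: aa => /eqP; rewrite a0 ip0l lt_eqF.
Qed.

Lemma root_opp a : a \in Phi -> - a \in Phi.
Proof.
move=> aP; have := root_reflection aP aP; rewrite reflectionE // root_norm //.
by rewrite scaler_nat mulr2n opprD addNKr.
Qed.

(** Equality in the Cauchy-Schwarz inequality. *)
Lemma root_ip_ge2 a b : a \in Phi -> b \in Phi -> 2 <= '[a, b] -> a = b.
Proof.
move=> aP bP ab; apply/eqP; rewrite -subr_eq0; apply/eqP/ip_le0.
by rewrite !(ipBl, ipBr) !root_norm // (ipC b a); lra.
Qed.

Lemma root_sub a b : a \in Phi -> b \in Phi -> '[a, b] = 1 -> a - b \in Phi.
Proof.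
by move=> aP bP ab; have := root_reflection bP aP; rewrite reflectionE // ab scale1r.
Qed.

Local Notation Lambda := (root_lattice G).

Lemma lattice_root a : a \in Phi -> Lambda a.
Proof. exact: int_span_mem. Qed.

Definition weight u := {in Phi, forall a, '[u, a] \is a Num.int}.

Lemma weight_lattice u v : weight u -> Lambda v -> '[u, v] \is a Num.int.
Proof.
move=> wu; move: v; apply: int_span_ind => [|v w uv uw|//]; rewrite ?ip0r //.
by rewrite ipBr; apply: rpredB.
Qed.

Lemma lattice_weight u : Lambda u -> weight u.
Proof.
move=> uL a aP; rewrite ipC; apply: (@weight_lattice a u) => // b; exact: root_ip_int.
Qed.

Lemma weightB u v : weight u -> weight v -> weight (u - v).
Proof. by move=> wu wv a aP; rewrite ipBl; apply: rpredB; [apply: wu | apply: wv]. Qed.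

Lemma lattice_even u : Lambda u -> exists2 n, n \is a @Num.int R & '[u, u] = 2 * n.
Proof.
move=> uL; suff [] : Lambda u /\ exists2 n, n \is a @Num.int R & '[u, u] = 2 * n by [].
move: u uL; apply: int_span_ind => [|u v|a aP].
- by split; [exact: int_span0 | exists 0 => //; rewrite ip0l mulr0].
- move=> [uL [m mint um]] [vL [n nint vn]]; split; first exact: int_spanB.
  exists (m + n - '[u, v]).
    by rewrite rpredB ?rpredD // weight_lattice //; apply: lattice_weight.
  by rewrite !(ipBl, ipBr) um vn (ipC v u); ring.
- by split; [exact: lattice_root | exists 1 => //; rewrite root_norm ?mulr1].
Qed.

(** In a shortest expression as a sum of roots no two roots have negative inner
    product, since they could be merged or cancelled; so the square lengths add
    up to at most the square length of the sum. *)
Lemma shortest_root_sum_norm s : {subset s <= Phi} ->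
  (forall t, {subset t <= Phi} -> \sum_(a <- t) a = \sum_(a <- s) a ->
     (size s <= size t)%N) ->
  2 * (size s)%:R <= '[\sum_(a <- s) a, \sum_(a <- s) a].
Proof.
elim: s => [|a s IH] sP smin; first by rewrite mulr0 ip_ge0.
have aP : a \in Phi by apply: sP; rewrite mem_head.
have sP' : {subset s <= Phi} by move=> b bs; apply: sP; rewrite in_cons bs orbT.
have {}IH : 2 * (size s)%:R <= '[\sum_(b <- s) b, \sum_(b <- s) b].
  apply: IH => // t tP ts; have := smin (a :: t).
  rewrite !big_cons ts ltnS; apply=> // b; rewrite in_cons => /predU1P[->//|].
  exact: tP.
have as0 : 0 <= '[a, \sum_(b <- s) b].
  rewrite ip_sumr big_seq; apply: sumr_ge0 => b bs; rewrite leNgt; apply/negP => ab.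
  have bP := sP' b bs; have sb := perm_to_rem bs.
  have remP : {subset rem b s <= Phi} by move=> c /mem_rem /sP'.
  have sE : \sum_(c <- a :: s) c = a + b + \sum_(c <- rem b s) c.
    by rewrite big_cons (perm_big _ sb) /= big_cons addrA.
  have size_s : size s = (size (rem b s)).+1.
    by rewrite size_rem // prednK //; case: (s) bs.
  have ab1 := int_num_ltD1 (root_ip_int aP bP) (rpred0 _) ab.
  have [ab2|ab2] := ltP ('[a, b] + 1) 0.
    have ab3 := int_num_ltD1 (rpredD (root_ip_int aP bP) (rpred1 _)) (rpred0 _) ab2.
    have eab : a = - b.
      by apply: root_ip_ge2; rewrite ?root_opp // ipNr; lra.
    have := smin (rem b s) remP; rewrite sE eab addNr add0r => /(_ erefl) /=.
    by rewrite size_s => /ltnW; rewrite ltnn.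
  have abP : a + b \in Phi.
    by rewrite -[b]opprK; apply: root_sub; rewrite ?root_opp // ipNr; lra.
  have tP : {subset a + b :: rem b s <= Phi}.
    by move=> c; rewrite in_cons => /predU1P[->//|]; apply: remP.
  by have := smin _ tP; rewrite sE big_cons => /(_ erefl) /=; rewrite size_s ltnn.
rewrite !big_cons !(ipDl, ipDr) (root_norm aP) (ipC _ a) /= -natr1; lra.
Qed.

Lemma lattice_root_sum u : Lambda u ->
  exists s, {subset s <= Phi} /\ \sum_(a <- s) a = u.
Proof.
move: u; apply: int_span_ind => [|u v [s [sP <-]] [t [tP <-]]|a aP].
- by exists [::]; rewrite big_nil.
- exists (s ++ [seq - a | a <- t]); rewrite big_cat big_map sumrN; split=> // a.
  by rewrite mem_cat => /orP[/sP //|/mapP[b /tP bP ->]]; apply: root_opp.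
- by exists [:: a]; rewrite big_seq1; split=> // b; rewrite inE => /eqP ->.
Qed.

Lemma lattice_norm u : Lambda u ->
  exists s, [/\ {subset s <= Phi}, \sum_(a <- s) a = u & 2 * (size s)%:R <= '[u, u]].
Proof.
move=> uL.
pose P n := `[< exists s, [/\ {subset s <= Phi}, \sum_(a <- s) a = u & size s = n] >].
have exP : exists n, P n.
  by have [s [sP su]] := lattice_root_sum uL; exists (size s); apply/asboolP; exists s.
case: (ex_minnP exP) => n /asboolP[s [sP su sn]] nmin; exists s; split=> //.
rewrite -su; apply: shortest_root_sum_norm => // t tP ts.
by rewrite sn; apply: nmin; apply/asboolP; exists t; rewrite ts.
Qed.

(** Up to the action of the Weyl group, these are [0] and the minuscule weights.
    They are also the shortest vectors of their cosets modulo the root lattice. *)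
Definition small u := weight u /\ {in Phi, forall a, `|'[u, a]| <= 1}.

Lemma smallP u a : small u -> a \in Phi ->
  [\/ '[u, a] = -1, '[u, a] = 0 | '[u, a] = 1].
Proof. by move=> [wu su] aP; apply: int_num_abs_le1; [apply: wu | apply: su]. Qed.

Lemma ip_reflection u v a : a \in Phi ->
  '[reflection G a u, v] = '[u, reflection G a v].
Proof.
by move=> aP; rewrite !reflectionE // ipBl ipBr ipZl ipZr (ipC a v) mulrC.
Qed.

Lemma reflectionK u a : a \in Phi -> reflection G a (reflection G a u) = u.
Proof.
move=> aP; rewrite !reflectionE // ipBl ipZl root_norm // -addrA -opprD -scalerDl.
have -> : '[u, a] + ('[u, a] - '[u, a] * 2) = 0 by ring.
by rewrite scale0r subr0.
Qed.

Lemma small_reflection u a : a \in Phi -> small u -> small (reflection G a u).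
Proof.
move=> aP [wu su]; split=> b bP; rewrite ip_reflection //.
  by apply: wu; apply: root_reflection.
by apply: su; apply: root_reflection.
Qed.

Lemma small_addP u a : small u -> a \in Phi -> reflect ('[u, a] = -1) `[< small (u + a) >].
Proof.
move=> su aP; apply: (iffP (asboolP _)) => [sua|ua].
  have [_ /(_ a aP)] := sua; rewrite ipDl root_norm //.
  by case: (smallP su aP) => -> //; rewrite ?add0r ger0_norm; lra.
by have := small_reflection aP su; rewrite reflectionE // ua scaleN1r opprK.
Qed.

(** Subtracting a root with which [u] has inner product at least [2] shortens [u]
    by at least [2] in square length, so the process stops. *)
Lemma reduce_to_small u : weight u -> exists2 v, small v & Lambda (u - v).
Proof.
have [n] := ubnP (Num.truncn '[u, u]); elim: n u => // n IH u un wu.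
have [su|] := pselect (small u).
  by exists u => //; rewrite subrr; exact: int_span0.
move=> nsu; have [a aP ua] : exists2 a, a \in Phi & 2 <= '[u, a].
  apply: contrapT => h; apply: nsu; split=> // a aP; rewrite ler_norml.
  have lt2 b : b \in Phi -> '[u, b] <= 1.
    move=> bP; rewrite leNgt; apply/negP => b1; apply: h; exists b => //.
    by have := int_num_ltD1 (rpred1 _) (wu b bP) b1.
  by rewrite lt2 // andbT lerNl -ipNr lt2 // root_opp.
have uaE : '[u - a, u - a] <= '[u, u] - 2.
  by rewrite !(ipBl, ipBr) (root_norm aP) (ipC a u); lra.
have [||v sv vL] := IH (u - a).
- by rewrite ltnS in un; apply: leq_trans un; apply: trunc_ltn; rewrite ?ip_ge0 //; lra.
- by apply: weightB => // ; apply: lattice_weight; apply: lattice_root.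
exists v => //; have -> : u - v = u - a - v + a by rewrite addrAC subrK.
by apply: int_spanD => //; apply: lattice_root.
Qed.

Section SimpleRoots.
Variable S : 'I_r -> 'rV[R]_r.
Hypothesis hS : simple_roots G S.

Lemma simple_root i : S i \in Phi. Proof. by case: hS. Qed.

Lemma simple_unit : \matrix_i S i \in unitmx.
Proof. by case: hS => _; rewrite row_free_unit. Qed.

Lemma root_simple_sum a : a \in Phi ->
  exists c : 'I_r -> nat, a = \sum_i S i *+ c i \/ a = - \sum_i S i *+ c i.
Proof. by case: hS => _ _ h; apply: h. Qed.

Lemma simple_separates u v : (forall i, '[u, S i] = '[v, S i]) -> u = v.
Proof.
move=> uv; have {}uv i : '[S i, u - v] = 0 by rewrite ipC ipBl uv subrr.
have : (\matrix_i S i) *m (gram G *m (u - v)^T) = 0.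
  apply/matrixP => i j; rewrite ord1 mxE [RHS]mxE -[RHS](uv i) /ip /pairing.
  by rewrite [in RHS]mxE; apply: eq_bigr => k _; rewrite mxE.
move/(congr1 (mulmx (invmx (\matrix_i S i)))); rewrite mulKmx ?simple_unit // mulmx0.
move=> guv; apply/eqP; rewrite -subr_eq0; apply/eqP/ip_le0.
by rewrite /ip /pairing guv mulmx0 mxE.
Qed.

Definition dominant u := forall i, 0 <= '[u, S i].

(** The linear functional that takes the value [1] at each simple root. *)
Definition height u : R := pairing u (invmx (\matrix_i S i) *m const_mx 1).

Lemma heightD u v : height (u + v) = height u + height v.
Proof. by rewrite /height /pairing mulmxDl mxE. Qed.

Lemma heightZ c u : height (c *: u) = c * height u.
Proof. by rewrite /height /pairing -scalemxAl mxE. Qed.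

Lemma height0 : height 0 = 0.
Proof. by rewrite -(scale0r 0) heightZ mul0r. Qed.

Lemma heightN u : height (- u) = - height u.
Proof. by rewrite -scaleN1r heightZ mulN1r. Qed.

Lemma heightB u v : height (u - v) = height u - height v.
Proof. by rewrite heightD heightN. Qed.

Lemma height_simple i : height (S i) = 1.
Proof.
have -> : S i = row i (\matrix_i S i) by rewrite rowK.
rewrite /height /pairing mulmxA -row_mul mulmxV ?simple_unit //.
by rewrite -row_mul mul1mx !mxE.
Qed.

Lemma height_sum (c : 'I_r -> nat) : height (\sum_i S i *+ c i) = (\sum_i c i)%:R.
Proof.
rewrite (big_morph height heightD height0) natr_sum; apply: eq_bigr => i _.
by rewrite -scaler_nat heightZ height_simple mulr1.
Qed.

Lemma height_root a : a \in Phi ->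
  (exists n : nat, height a = n.+1%:R) \/ (exists n : nat, height a = - n.+1%:R).
Proof.
move=> aP; have a0 := root_neq0 aP.
have [c ac] := root_simple_sum aP; case cn: (\sum_i c i)%N => [|n].
  have c0 i : c i = 0%N.
    by move/eqP: cn; rewrite sum_nat_eq0 => /forallP/(_ i)/eqP.
  by move: a0; case: ac => ->; rewrite big1 ?oppr0 ?eqxx // => i _; rewrite c0.
by case: ac => ->; [left | right]; exists n; rewrite ?heightN height_sum cn.
Qed.

Lemma height_root_neq0 a : a \in Phi -> height a != 0.
Proof. by move=> /height_root[] [n ->]; rewrite ?oppr_eq0 pnatr_eq0. Qed.

(** If the inner product were [1], then [S i - S j] would be a root of height
    [0]. *)
Lemma simple_ip i j : i != j -> '[S i, S j] = 0 \/ '[S i, S j] = -1.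
Proof.
have [iP jP] := (simple_root i, simple_root j).
have ij_int := root_ip_int iP jP => ij.
have ij_neq : S i != S j.
  apply: contraNneq ij => eij; apply/eqP.
  have : row i (\matrix_k S k) = row j (\matrix_k S k) by rewrite !rowK.
  move/(congr1 (mulmx^~ (invmx (\matrix_k S k)))).
  rewrite -!row_mul mulmxV ?simple_unit // => /matrixP/(_ 0 j).
  rewrite !mxE eqxx; case: eqP => // _ /eqP.
  by rewrite eq_sym oner_eq0.
have lt2 : '[S i, S j] < 2.
  by rewrite ltNge; apply/negP => /root_ip_ge2 eij; rewrite eij ?eqxx in ij_neq.
have gtN2 : -2 < '[S i, S j].
  rewrite ltNge; apply/negP => le2.
  have eij : S i = - S j by apply: root_ip_ge2; rewrite ?root_opp // ipNr; lra.
  by have := height_simple i; rewrite eij heightN height_simple; lra.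
have neq1 : '[S i, S j] != 1.
  apply/eqP => /(root_sub iP jP)/height_root_neq0.
  by rewrite heightB !height_simple subrr eqxx.
have le1 : '[S i, S j] <= 1.
  by have := int_num_ltD1 ij_int (rpred_nat _ 2) lt2; lra.
have geN1 : -1 <= '[S i, S j].
  have N2_int : -2 \is a @Num.int R by rewrite rpredN rpred_nat.
  by have := int_num_ltD1 N2_int ij_int gtN2; lra.
have abs_le1 : `|'[S i, S j]| <= 1 by rewrite ler_norml geN1.
case: (int_num_abs_le1 ij_int abs_le1) => e; [by right | by left |].
by rewrite e eqxx in neq1.
Qed.

Lemma dominant_root_sign a : a \in Phi ->
  (forall u, dominant u -> 0 <= '[u, a]) \/ (forall u, dominant u -> '[u, a] <= 0).
Proof.
move=> /root_simple_sum[c ac].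
have sum_ge0 u : dominant u -> 0 <= '[u, \sum_i S i *+ c i].
  move=> du; rewrite ip_sumr; apply: sumr_ge0 => i _.
  by rewrite -scaler_nat ipZr mulr_ge0.
by case: ac => ->; [left | right] => u du; rewrite ?ipNr ?oppr_le0; apply: sum_ge0.
Qed.

(** If [u] and [v] differ by a lattice vector, write it as a shortest sum of [n]
    roots.  Dominance makes the inner products of [u] and [v] with each root have
    the same sign, so the root contributes at most [1] to the square length of
    [u - v], which is at least [2 n]. *)
Lemma small_dominant_unique u v : small u -> small v -> dominant u -> dominant v ->
  Lambda (u - v) -> u = v.
Proof.
move=> su sv du dv /lattice_norm[s [sP suv]].
have : '[u - v, u - v] <= (size s)%:R.
  rewrite -{2}suv ip_sumr -sum1_size natr_sum !big_seq.
  apply: ler_sum => a /sP aP; rewrite ipBl.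
  by case: (dominant_root_sign aP) => sgn; have := sgn u du; have := sgn v dv;
    case: (smallP su aP) => ->; case: (smallP sv aP) => ->; lra.
move=> le1 le2; have /eqP : (size s)%:R = 0 :> R.
  have := ler0n R (size s); lra.
rewrite pnatr_eq0 => /nilP s0; apply/eqP; rewrite -subr_eq0 -suv s0 big_nil eqxx //.
Qed.

(** The simple roots form a basis, so the height is a fixed linear combination of
    the inner products with them, and these are bounded on small weights. *)
Lemma small_height_bounded : exists B, forall u, small u -> height u <= B.
Proof.
pose M := \matrix_i S i.
have gram_unit : gram G \in unitmx.
  rewrite -row_free_unit; apply/inj_row_free => v v0; apply: ip_le0.
  by rewrite /ip /pairing mulmxA v0 mul0mx mxE.
pose c : 'cV[R]_r := invmx (gram G *m M^T) *m (invmx M *m const_mx 1).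
exists (\sum_i `|c i 0|) => u [_ su].
have -> : height u = \sum_i '[u, S i] * c i 0.
  have cE : invmx M *m const_mx 1 = (gram G *m M^T) *m c.
    by rewrite mulKVmx // unitmx_mul gram_unit unitmx_tr simple_unit.
  rewrite /height /pairing cE mulmxA mxE; apply: eq_bigr => i _; congr (_ * _).
  rewrite /ip /pairing !mulmxA [LHS]mxE [RHS]mxE.
  by apply: eq_bigr => k _; rewrite !mxE.
apply: ler_sum => i _; apply: le_trans (ler_norm _) _.
by rewrite normrM ler_piMl // su // simple_root.
Qed.

(** Adding simple roots raises the height, so a small weight can be made dominant
    one simple reflection at a time. *)
Lemma small_raise_ind (P : 'rV[R]_r -> Prop) :
  (forall u, small u -> dominant u -> P u) ->
  (forall u i, small u -> '[u, S i] = -1 -> P (u + S i) -> P u) ->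
  forall u, small u -> P u.
Proof.
move=> Pdom Praise; have [B leB] := small_height_bounded => u.
have [n] := ubnP (Num.truncn (B - height u)); elim: n u => // n IH u un su.
have [du|/existsNP[i ui]] := pselect (dominant u); first exact: Pdom.
have ui1 : '[u, S i] = -1.
  by case: (smallP su (simple_root i)) => // e; case: ui; rewrite e.
have sui : small (u + S i) by apply/asboolP/(small_addP su (simple_root i)).
apply: (Praise _ i) => //; apply: IH => //.
rewrite ltnS in un; apply: leq_trans un.
have := leB _ sui; rewrite heightD height_simple => b.
by apply: trunc_ltn; lra.
Qed.

Lemma small_to_dominant u : small u ->
  exists v, [/\ small v, dominant v & Lambda (u - v)].
Proof.
move: u; apply: small_raise_ind => [u su du|u i su ui [v [sv dv vL]]].
  by exists u; rewrite subrr; split=> //; exact: int_span0.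
exists v; split=> //; have -> : u - v = u + S i - v - S i.
  by rewrite -addrAC addrK.
by apply: int_spanB => //; apply: lattice_root; apply: simple_root.
Qed.

Lemma coset_representative u : weight u ->
  exists v, [/\ small v, dominant v & Lambda (u - v)].
Proof.
move=> /reduce_to_small[v /small_to_dominant[w [sw dw vw]] uv].
by exists w; split=> //; rewrite -(subrK v u) -addrA; apply: int_spanD.
Qed.

End SimpleRoots.
End RootSystem.

(** * Weights of a minuscule representation *)

Section MinusculeWeights.
Variables (R : realType) (r : nat) (G : group_datum R r).
Hypothesis hG : compact_simple_simply_laced G.
Variable S : 'I_r -> 'rV[R]_r.
Hypothesis hS : simple_roots G S.

Local Notation Phi := (root_seq G).
Local Notation "''[' u , v ]" := (ip G u v).
Local Notation Lambda := (root_lattice G).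
Local Notation SP := (simple_root hS).

Lemma small_intro u :
  {in Phi, forall a, [\/ '[u, a] = -1, '[u, a] = 0 | '[u, a] = 1]} -> small G u.
Proof.
move=> h; split=> a /h[] ->;
  by rewrite ?rpredN ?rpred0 ?rpred1 ?normrN ?normr0 ?normr1.
Qed.

Lemma ip_reflection2 u v a : a \in Phi ->
  '[reflection G a u, reflection G a v] = '[u, v].
Proof. by move=> aP; rewrite ip_reflection // reflectionK. Qed.

Lemma positive_root_descent a : a \in Phi -> 0 < height S a ->
  exists i, a = S i \/ '[a, S i] = 1.
Proof.
move=> aP ha; have [c ac] := root_simple_sum hS aP.
have {}ac : a = \sum_i S i *+ c i.
  case: ac => // ac; move: ha; rewrite ac heightN (height_sum hS) oppr_gt0.
  by rewrite ltNge ler0n.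
have [i ai] : exists i, 0 < '[a, S i].
  apply: contrapT => h; have := root_norm hG aP; rewrite {2}ac (ip_sumr hG) => s2.
  have : \sum_i '[a, S i *+ c i] <= 0; last by rewrite s2; lra.
  apply: sumr_le0 => i _; rewrite -scaler_nat (ipZr hG) mulr_ge0_le0 //.
  by rewrite leNgt; apply/negP => ai; apply: h; exists i.
have ai_int := root_ip_int hG aP (SP i).
exists i; have [ai2|ai2] := leP 2 '[a, S i].
  by left; apply: (root_ip_ge2 hG aP (SP i)).
have := int_num_ltD1 (rpred0 _) ai_int ai.
by have := int_num_ltD1 ai_int (rpred_nat _ 2) ai2; right; lra.
Qed.

(** A positive root has positive inner product with one of the simple roots of
    which it is the sum; reflecting in that root lowers the height by [1]. *)
(** Every root is moved to a simple one by reflections, and these preserve [O]. *)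
Lemma reflection_closed_small (O : set 'rV[R]_r) :
  (forall a u, a \in Phi -> O u -> O (reflection G a u)) ->
  (forall u i, O u -> [\/ '[u, S i] = -1, '[u, S i] = 0 | '[u, S i] = 1]) ->
  forall u, O u -> small G u.
Proof.
move=> Orefl Osimple.
have pos n a u : a \in Phi -> height S a = n.+1%:R -> O u ->
    [\/ '[u, a] = -1, '[u, a] = 0 | '[u, a] = 1].
  elim: n a u => [|n IH] a u aP ha Ou.
    have [|i [->|ai]] := positive_root_descent aP; first by rewrite ha.
      exact: Osimple.
    have := height_root_neq0 hG hS (root_sub hG aP (SP i) ai).
    by rewrite heightB (height_simple hS) ha subrr eqxx.
  have [|i [->|ai]] := positive_root_descent aP; first by rewrite ha ltr0n.
    exact: Osimple.
  rewrite -(ip_reflection2 u a (SP i)) (reflectionE hG a (SP i)) ai scale1r.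
  apply: IH; [exact: (root_sub hG aP (SP i) ai) | | by apply: Orefl => //; apply: SP].
  by rewrite heightB (height_simple hS) ha -[n.+2%:R]natr1 addrK.
move=> u Ou; apply: small_intro => a aP.
case: (height_root hG hS aP) => -[n hn]; first exact: pos hn Ou.
have := pos n (- a) u (root_opp hG aP); rewrite heightN hn opprK => /(_ erefl Ou).
by rewrite ipNr //; case=> e; [constructor 3 | constructor 2 | constructor 1]; lra.
Qed.

Lemma weyl_orbit_self u : weyl_orbit G u u.
Proof. by exists [::]. Qed.

Lemma weyl_orbit_reflection u v a : a \in Phi ->
  weyl_orbit G u v -> weyl_orbit G u (reflection G a v).
Proof.
move=> aP [s sP ->]; exists (a :: s) => // b.
by rewrite in_cons => /predU1P[->//|]; apply: sP.
Qed.

Lemma weyl_orbit_norm u v : weyl_orbit G u v -> '[v, v] = '[u, u].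
Proof.
case=> s sP ->; elim: s sP => //= a s IH sP.
rewrite ip_reflection2 ?IH // => [b bs|]; last by rewrite sP ?mem_head.
by apply: sP; rewrite in_cons bs orbT.
Qed.

Lemma pairingD u v (x : 'cV[R]_r) : pairing (u + v) x = pairing u x + pairing v x.
Proof. by rewrite /pairing mulmxDl mxE. Qed.

Lemma pairingB u v (x : 'cV[R]_r) : pairing (u - v) x = pairing u x - pairing v x.
Proof. by rewrite pairingD /pairing mulNmx [in X in _ + X]mxE. Qed.

Section HighestWeight.
Variables (V : vectType R[i]) (h e f : 'I_r -> 'End(V)).
Hypothesis hrep : representation G S h e f.

Lemma bracket_apply (x y : 'End(V)) v : bracket x y v = x (y v) - y (x v).
Proof. by rewrite add_lfunE opp_lfunE !comp_lfunE. Qed.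

Lemma weight_vector_e u v j :
  weight_vector G S h u v -> weight_vector G S h (u + S j) (e j v).
Proof.
case: hrep => _ _ he _ uv i; have [/lfunP/(_ v) + _] := he i j.
rewrite bracket_apply scale_lfunE (uv i) linearZ /= => /eqP.
rewrite subr_eq => /eqP ->; rewrite -scalerDl; congr (_ *: _).
by rewrite /cartan pairingD addrC rmorphD.
Qed.

Lemma weight_vector_f u v j :
  weight_vector G S h u v -> weight_vector G S h (u - S j) (f j v).
Proof.
case: hrep => _ _ he _ uv i; have [_ /lfunP/(_ v)] := he i j.
rewrite bracket_apply opp_lfunE scale_lfunE (uv i) linearZ /= => /eqP.
rewrite subr_eq => /eqP ->; rewrite -scaleNr -scalerDl; congr (_ *: _).
by rewrite /cartan pairingB addrC rmorphB.
Qed.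

(** All weights have the same length, and [e], [f] shift weights by simple roots;
    [e v != 0] and [f v != 0] therefore force the value on the simple coroot, and
    if both vanish the commutation relation does. *)
Lemma orbit_weight_simple u0 u v i : weights G S h = weyl_orbit G u0 ->
  v != 0 -> weight_vector G S h u v ->
  [\/ '[u, S i] = -1, '[u, S i] = 0 | '[u, S i] = 1] /\ (e i v = 0 -> 0 <= '[u, S i]).
Proof.
move=> orb v0 uv.
have norm w x : x != 0 -> weight_vector G S h w x -> '[w, w] = '[u0, u0].
  by move=> x0 wx; apply: weyl_orbit_norm; rewrite -orb; exists x.
have nu := norm u v v0 uv.
have [ev|ev] := eqVneq (e i v) 0; last first.
  have := norm _ _ ev (weight_vector_e i uv).
  rewrite !(ipDl, ipDr) // nu (root_norm hG (SP i)) (ipC hG (S i)) => n1.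
  by split=> [|ev0]; [constructor 1; lra | rewrite ev0 eqxx in ev].
have [fv|fv] := eqVneq (f i v) 0; last first.
  have := norm _ _ fv (weight_vector_f i uv).
  rewrite !(ipBl, ipBr) // nu (root_norm hG (SP i)) (ipC hG (S i)) => n1.
  have u1 : '[u, S i] = 1 by lra.
  by rewrite u1; split=> [|_]; [constructor 3 | exact: ler01].
case: hrep => _ /(_ i i) + _ _; rewrite eqxx => /lfunP/(_ v).
rewrite bracket_apply ev fv (linear0 (e i)) (linear0 (f i)) subrr (uv i) pairing_coroot ?SP //.
move/esym/eqP; rewrite scaler_eq0 (negbTE v0) orbF => /eqP[->].
by split=> [|_]; [constructor 2 | exact: lexx].
Qed.

End HighestWeight.

Lemma minuscule_weight_small u : minuscule_weight G S u -> small G u /\ dominant G S u.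
Proof.
move=> [V [h [e [f [[hrep _ _ [u0 orb]] [v [v0 uv ev]]]]]]].
split; last by move=> i; have [_] := orbit_weight_simple hrep i orb v0 uv; apply.
apply: (@reflection_closed_small (weights G S h)); last by exists v.
- by move=> a w aP; rewrite orb; apply: weyl_orbit_reflection.
- by move=> w i [x x0 wx]; have [] := orbit_weight_simple hrep i orb x0 wx.
Qed.

End MinusculeWeights.

(** * The representation with a given minuscule highest weight *)

Section MinusculeRepresentation.
Variables (R : realType) (r : nat) (G : group_datum R r).
Hypothesis hG : compact_simple_simply_laced G.
Variable S : 'I_r -> 'rV[R]_r.
Hypothesis hS : simple_roots G S.
Variable u : 'rV[R]_r.
Hypotheses (u_small : small G u) (u_dom : dominant G S u).
Implicit Types x y : 'rV[R]_r.

Local Notation Phi := (root_seq G).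
Local Notation "''[' u , v ]" := (ip G u v).
Local Notation Lambda := (root_lattice G).
Local Notation SP := (simple_root hS).

(** This is the Weyl orbit of [u] ([coset_weightsE]), in a form for which
    membership of [x + a] and [x - a] can be read off from inner products. *)
Definition coset_weights : set 'rV[R]_r := [set x | small G x /\ Lambda (u - x)].

Local Notation X := coset_weights.

Lemma coset_weights_self : X u.
Proof. by split=> //; rewrite subrr; exact: int_span0. Qed.

(** A vector is determined by its inner products with the simple roots, and these
    take only three values here. *)
Lemma coset_weights_finite : finite_set X.
Proof.
pose g (c : {ffun 'I_r -> 'I_3}) : 'rV[R]_r :=
  xget 0 [set x | forall i, '[x, S i] = (c i : nat)%:R - 1].
apply: (@sub_finite_set _ _ (g @` setT)); last exact: finite_image.
move=> x [sx _].
have code i : exists k : 'I_3, '[x, S i] = (k : nat)%:R - 1.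
  by case: (smallP sx (SP i)) => ->;
    [exists (inord 0) | exists (inord 1) | exists (inord 2)]; rewrite inordK //; lra.
have [c xc] := boolp.choice code; exists (finfun c) => //.
rewrite /g; case: xgetP => [y _ xy|/(_ x)] /=.
  by apply: (simple_separates hG hS) => i; rewrite xy ffunE xc.
by case=> i; rewrite ffunE xc.
Qed.

Lemma coset_weights_ip x a : X x -> a \in Phi ->
  [\/ '[x, a] = -1, '[x, a] = 0 | '[x, a] = 1].
Proof. by move=> [sx _]; apply: smallP. Qed.

Lemma coset_weights_sub x a : X x -> a \in Phi -> X (x - a) <-> '[x, a] = 1.
Proof.
move=> [sx xL] aP; have aNP := root_opp hG aP.
have eN : '[x, - a] = -1 <-> '[x, a] = 1 by rewrite (ipNr hG); split=> h; lra.
split=> [[sxa _]|xa1].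
  by apply/eN; apply/(small_addP hG sx aNP)/asboolP.
split; first by apply/asboolP/(small_addP hG sx aNP)/eN.
have -> : u - (x - a) = u - x + a by rewrite opprB addrAC addrA addrAC.
by apply: int_spanD => //; apply: lattice_root.
Qed.

Lemma coset_weights_add x a : X x -> a \in Phi -> X (x + a) <-> '[x, a] = -1.
Proof.
move=> xX aP; have := coset_weights_sub xX (root_opp hG aP); rewrite opprK (ipNr hG).
by move=> ->; split=> ?; lra.
Qed.

Lemma coset_weights_reflection x a : X x -> a \in Phi -> X (reflection G a x).
Proof.
move=> xX aP; rewrite reflectionE //; case: (coset_weights_ip xX aP) => xa; rewrite xa.
- by rewrite scaleN1r opprK; apply/coset_weights_add.
- by rewrite scale0r subr0.
- by rewrite scale1r; apply/coset_weights_sub.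
Qed.

Lemma coset_weights_dominant x : X x -> dominant G S x -> x = u.
Proof.
by move=> [sx xL] dx; apply/esym; apply: (small_dominant_unique hG hS).
Qed.

(** Raising by simple roots connects every weight of the orbit to [u], the only
    dominant one. *)
Lemma coset_weights_raise (P : 'rV[R]_r -> Prop) : P u ->
  (forall x i, X x -> X (x + S i) -> '[x, S i] = -1 -> P (x + S i) -> P x) ->
  forall x, X x -> P x.
Proof.
move=> Pu Praise x [sx]; move: x sx.
apply: (small_raise_ind hG hS) => [x sx dx xL|x i sx xi IH xL].
  by rewrite (coset_weights_dominant _ dx).
have xiX : X (x + S i) by apply/(coset_weights_add _ (SP i)).
by apply: (Praise x i) => //; apply: IH; case: xiX.
Qed.

Lemma coset_weightsE : X = weyl_orbit G u.
Proof.
apply/seteqP; split=> [|_ [s sP ->]].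
  apply: coset_weights_raise => [|x i xX xiX xi]; first exact: weyl_orbit_self.
  have {2}-> : x = reflection G (S i) (x + S i).
    rewrite reflectionE ?SP // ipDl xi (root_norm hG (SP i)).
    by rewrite (_ : -1 + 2 = 1) ?scale1r ?addrK //; ring.
  exact: (weyl_orbit_reflection (SP i)).
elim: s sP => [|a s IH] sP /=; first exact: coset_weights_self.
apply: coset_weights_reflection; last by rewrite sP ?mem_head.
by apply: IH => b bs; apply: sP; rewrite in_cons bs orbT.
Qed.

Local Notation T := (fset_set X).
Local Notation C := (R[i])^o.

Definition weight_space : vectType R[i] := {ffun T -> C}.
Local Notation V := weight_space.
Implicit Types (F : V) (t : T).

Lemma index_weight t : X (val t).
Proof. by have := valP t; rewrite in_fset_set ?inE //; exact: coset_weights_finite. Qed.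

Lemma weight_index x : X x -> exists t : T, val t = x.
Proof.
move=> xX; have xT : x \in fset_set X.
  by rewrite in_fset_set ?inE //; exact: coset_weights_finite.
by exists [` xT]%fset.
Qed.

(** Functions on the weights are extended by zero, so that shifting the argument
    by a root makes sense everywhere. *)
Definition extend F x : C := if insub x is Some t then (F : {ffun T -> C}) t else 0.

Lemma extend_val F t : extend F (val t) = (F : {ffun T -> C}) t.
Proof. by rewrite /extend valK. Qed.

Lemma extend_out F x : ~ X x -> extend F x = 0.
Proof. by rewrite /extend; case: insubP => // t _ <- []; exact: index_weight. Qed.

Lemma extend_inj F1 F2 : (forall x, X x -> extend F1 x = extend F2 x) -> F1 = F2.
Proof.
by move=> e; apply/ffunP => t; rewrite -!extend_val; apply: e; exact: index_weight.
Qed.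

Lemma extendP c F1 F2 x : extend (c *: F1 + F2) x = c *: extend F1 x + extend F2 x.
Proof.
by rewrite /extend; case: insubP => [t _ _|_]; rewrite ?ffunE // scaler0 addr0.
Qed.

Lemma extendB F1 F2 x : extend (F1 - F2) x = extend F1 x - extend F2 x.
Proof. by rewrite -scaleN1r addrC extendP scaleN1r addrC. Qed.

Lemma extendZ (c : R[i]) F x : extend (c *: F) x = c * extend F x.
Proof. by rewrite /extend; case: insubP => [t _ _|_]; rewrite ?ffunE ?mulr0. Qed.

Lemma extend0 x : extend 0 x = 0.
Proof. by rewrite /extend; case: insubP => // t _ _; rewrite ffunE. Qed.

(** Common form of the Cartan elements, for which [y] is [0], and of the root
    vectors, for which [k] is [1]. *)
Definition operator_of (k : 'rV[R]_r -> R[i]) (y : 'rV[R]_r) F : V :=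
  [ffun t : T => k (val t) * extend F (val t - y)] : {ffun T -> C}.

Lemma operator_of_linear k y : linear (operator_of k y).
Proof.
move=> c F1 F2; apply/ffunP => t; rewrite !ffunE extendP.
by rewrite mulrDr; congr (_ + _); rewrite /GRing.scale /= mulrCA.
Qed.

HB.instance Definition _ k y := GRing.isLinear.Build _ _ _ _ (operator_of k y)
  (operator_of_linear k y).

Definition operator k y : 'End(V) := linfun (operator_of k y).

Lemma operatorE k y F x : X x -> extend (operator k y F) x = k x * extend F (x - y).
Proof.
by move=> /weight_index[t <-]; rewrite lfunE extend_val ffunE.
Qed.

Definition shift y : 'End(V) := operator (fun=> 1) y.
Definition diag i : 'End(V) := operator (fun x => ('[x, S i])%:C) 0.

Lemma shiftE y F x : X x -> extend (shift y F) x = extend F (x - y).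
Proof. by move=> xX; rewrite operatorE // mul1r. Qed.

Lemma diagE i F x : X x -> extend (diag i F) x = ('[x, S i])%:C * extend F x.
Proof. by move=> xX; rewrite operatorE // subr0. Qed.

Lemma shift_shiftE a y F x : X x -> a \in Phi ->
  extend (shift a (shift y F)) x = if '[x, a] == 1 then extend F (x - a - y) else 0.
Proof.
move=> xX aP; rewrite shiftE //; case: eqP => xa.
  by rewrite shiftE //; apply/(coset_weights_sub xX aP).
by rewrite extend_out // => /(coset_weights_sub xX aP).
Qed.

(** If both shifts keep the weight in the orbit in one order, they do so in the
    other: the intermediate inner product [1 + '[a, b]] can only be [1]. *)
Lemma shiftC a b F : a \in Phi -> b \in Phi -> 0 <= '[a, b] ->
  shift a (shift b F) = shift b (shift a F).
Proof.
move=> aP bP ab; apply: extend_inj => x xX; rewrite !shift_shiftE // addrAC.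
have [yX|/extend_out->] := pselect (X (x - b - a)); last by rewrite !if_same.
have step c d : c \in Phi -> d \in Phi -> 0 <= '[c, d] -> X (x - c - d) ->
    '[x, c] = 1 -> '[x, d] = 1.
  move=> cP dP cd yX' /(coset_weights_sub xX cP) xcX.
  have := (coset_weights_sub xcX dP).1 yX'; rewrite ipBl => xd.
  by case: (coset_weights_ip xX dP) => // e; lra.
case: eqP => [xa|xa]; case: eqP => // xb.
- by case: xb; apply: (step a b); rewrite // addrAC.
- by case: xa; apply: (step b a); rewrite // (ipC hG).
Qed.

Lemma shift_sqr0 a F : a \in Phi -> shift a (shift a F) = 0.
Proof.
move=> aP; apply: extend_inj => x xX; rewrite shift_shiftE // extend0.
case: eqP => // xa; have xaX := (coset_weights_sub xX aP).2 xa.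
rewrite extend_out // => /(coset_weights_sub xaX aP).
by rewrite ipBl xa (root_norm hG aP); lra.
Qed.

(** After the shifts by [a] and [b] the inner product with [a] is [0], so another
    shift by [a] leaves the orbit. *)
Lemma shift_braid0 a b F : a \in Phi -> b \in Phi -> '[a, b] = -1 ->
  shift a (shift b (shift a F)) = 0.
Proof.
move=> aP bP ab; apply: extend_inj => x xX; rewrite shift_shiftE // extend0.
case: eqP => // xa; have xaX := (coset_weights_sub xX aP).2 xa.
have [yX|/extend_out-> //] := pselect (X (x - a - b)).
rewrite shiftE // extend_out // => /(coset_weights_sub yX aP).
by rewrite !ipBl xa (root_norm hG aP) (ipC hG b a) ab; lra.
Qed.

Lemma shift_opp a F x : X x -> a \in Phi ->
  extend (shift a (shift (- a) F)) x - extend (shift (- a) (shift a F)) x =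
  ('[x, a])%:C * extend F x.
Proof.
move=> xX aP; rewrite !shift_shiftE ?root_opp // (ipNr hG) opprK subrK addrK.
have N11 : (-1 == 1 :> R) = false by apply/eqP; lra.
case: (coset_weights_ip xX aP) => ->; rewrite ?opprK ?oppr0 ?eqxx ?N11.
- by rewrite sub0r rmorphN1 mulN1r.
- by rewrite [0 == 1]eq_sym oner_eq0 subrr mul0r.
- by rewrite subr0 mul1r.
Qed.

Lemma diag_shift i y F :
  diag i (shift y F) - shift y (diag i F) = ('[y, S i])%:C *: shift y F.
Proof.
apply: extend_inj => x xX.
rewrite extendB extendZ diagE // !shiftE //.
have [yX|/[dup]/extend_out-> /extend_out->] := pselect (X (x - y)); last first.
  by rewrite !mulr0 subrr.
by rewrite diagE // -mulrBl ipBl -rmorphB opprB addrCA subrr addr0.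
Qed.

Lemma iter2_bracket (x y : 'End(V)) F :
  iter 2 (bracket x) y F = x (x (y F)) - x (y (x F)) - (x (y (x F)) - y (x (x F))).
Proof. by rewrite /= !bracket_apply linearB. Qed.

(** For orthogonal roots the relation is commutation.  Otherwise it expands to
    the products [shift a * shift a], which vanish, and to
    [shift a * shift b * shift a], which vanishes as well. *)
Lemma serre_shift a b (n : nat) : a \in Phi -> b \in Phi ->
  '[a, b] = 0 \/ '[a, b] = -1 -> n%:R = 1 - '[a, b] ->
  iter n (bracket (shift a)) (shift b) = 0.
Proof.
move=> aP bP ab nE.
have {nE}natE (k : nat) : 1 - '[a, b] = k%:R -> n = k.
  by move=> k1; apply/eqP; rewrite -(eqr_nat R) nE k1.
case: ab => ab; apply/lfunP => F; rewrite zero_lfunE.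
  rewrite (natE 1%N) ?ab ?subr0 //= bracket_apply shiftC ?subrr //.
  by rewrite ab.
rewrite (natE 2%N) ?ab ?opprK // iter2_bracket.
by rewrite (shift_sqr0 (shift b F)) // shift_braid0 // shift_sqr0 // (linear0 (shift b)) !subr0.
Qed.

(** Since two shifts never interfere, no signs are needed in the action of the
    Chevalley generators. *)
Lemma coset_weights_representation :
  representation G S diag (fun i => shift (S i)) (fun i => shift (- S i)).
Proof.
have cartanE i j : cartan G S i j = '[S j, S i] by rewrite /cartan pairing_coroot ?SP.
split.
- move=> i j; apply/lfunP => F; apply: extend_inj => x xX.
  rewrite bracket_apply zero_lfunE.
  have -> : diag i (diag j F) = diag j (diag i F).
    by apply: extend_inj => y yX; rewrite !diagE // mulrCA.
  by rewrite subrr.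
- move=> i j; apply/lfunP => F; rewrite bracket_apply; case: eqVneq => [->|ij].
    apply: extend_inj => x xX; rewrite diagE // -shift_opp ?SP //.
    by rewrite extendB.
  rewrite shiftC ?subrr ?zero_lfunE ?root_opp ?SP // (ipNr hG).
  by case: (simple_ip hG hS ij) => ->; lra.
- move=> i j; rewrite cartanE; split; apply/lfunP => F;
    rewrite bracket_apply diag_shift ?opp_lfunE scale_lfunE //.
  by rewrite ipNl rmorphN scaleNr.
move=> i j m ij; rewrite cartanE (ipC hG) => mE; have ijip := simple_ip hG hS ij.
split; apply: serre_shift; rewrite ?root_opp ?SP //.
  by rewrite ipNl (ipNr hG) opprK.
by rewrite ipNl (ipNr hG) opprK.
Qed.

Definition point x : V := [ffun t : T => (val t == x)%:R] : {ffun T -> C}.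

Lemma extend_point x y : X y -> extend (point x) y = (y == x)%:R.
Proof. by move=> /weight_index[t <-]; rewrite extend_val ffunE. Qed.

Lemma point_neq0 x : X x -> point x != 0.
Proof.
move=> xX; apply/eqP => /(congr1 (extend^~ x))/eqP.
by rewrite extend_point // extend0 eqxx oner_eq0.
Qed.

Lemma diag_point i x : X x -> diag i (point x) = ('[x, S i])%:C *: point x.
Proof.
move=> xX; apply: extend_inj => y yX; rewrite diagE // extendZ extend_point //.
by case: eqP => [->|_] //; rewrite !mulr0.
Qed.

Lemma shift_point a x : X x -> X (x + a) -> shift a (point x) = point (x + a).
Proof.
move=> xX xaX; apply: extend_inj => y yX; rewrite shiftE // [RHS]extend_point //.
have [->|yxa] := eqVneq y (x + a).
  by rewrite addrK extend_point // eqxx.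
have [yaX|/extend_out-> //] := pselect (X (y - a)).
by rewrite extend_point // subr_eq (negbTE yxa).
Qed.

Lemma point_sum F : F = \sum_(t : T) (F : {ffun T -> C}) t *: point (val t).
Proof.
apply/ffunP => t; rewrite sum_ffunE (bigD1 t) //= big1 ?addr0 => [|s st].
  by rewrite !ffunE eqxx /GRing.scale /= mulr1.
by rewrite !ffunE (inj_eq val_inj) eq_sym (negbTE st) scaler0.
Qed.

Section InvariantSubspace.
Variable U : {vspace V}.
Hypothesis U_inv :
  invariant_subspace diag (fun i => shift (S i)) (fun i => shift (- S i)) U.

Lemma invariant_apply i F : F \in U ->
  [/\ diag i F \in U, shift (S i) F \in U & shift (- S i) F \in U].
Proof.
move=> FU; case: (U_inv i) => hU eU fU.
by split; [apply: (subvP hU) | apply: (subvP eU) | apply: (subvP fU)];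
  apply: memv_img.
Qed.

(** The simple coroots separate the weights, so the support of a nonzero vector
    can be shrunk to one point. *)
Lemma invariant_contains_point F : F \in U -> F != 0 -> exists2 x, X x & point x \in U.
Proof.
pose supp (F : {ffun T -> C}) := [pred t | F t != 0].
have [n] := ubnP #|supp F|; elim: n F => // n IH F Fn FU F0.
have [t Ft] : exists t, (F : {ffun T -> C}) t != 0.
  apply: contrapT => h; case/eqP: F0; apply/ffunP => t; rewrite ffunE.
  by apply: contrapT => /eqP Ft; apply: h; exists t.
have [[s [st Fs]]|single] := pselect (exists s, s != t /\ (F : {ffun T -> C}) s != 0).
  have [i si] : exists i, '[val s, S i] != '[val t, S i].
    apply: contrapT => h; case/eqP: st; apply/val_inj/(simple_separates hG hS) => i.
    by apply: contrapT => /eqP e; apply: h; exists i.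
  pose D : V := diag i F - ('[val t, S i])%:C *: F.
  have DE (y : T) : (D : {ffun T -> C}) y =
      ('[val y, S i] - '[val t, S i])%:C * (F : {ffun T -> C}) y.
    rewrite -!extend_val extendB extendZ diagE ?rmorphB ?mulrBl //.
    exact: index_weight.
  apply: (IH D).
  - rewrite ltnS in Fn; apply: leq_trans Fn; apply: proper_card.
    apply/properP; split.
      by apply/fintype.subsetP => y; rewrite !inE DE mulf_eq0 negb_or => /andP[].
    by exists t; rewrite !inE // DE subrr mul0r eqxx.
  - by apply: rpredB; [case: (invariant_apply i FU) | apply: rpredZ].
  - apply/eqP => D0; have /eqP := DE s; rewrite D0 ffunE eq_sym mulf_eq0 (negbTE Fs) orbF.
    by rewrite fmorph_eq0 subr_eq0 (negbTE si).
exists (val t); first exact: index_weight.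
have Ft_point : F = (F : {ffun T -> C}) t *: point (val t).
  rewrite {1}(point_sum F) (bigD1 t) //= big1 ?addr0 // => s st.
  have [->|Fs] := eqVneq ((F : {ffun T -> C}) s) 0; first by rewrite scale0r.
  by case: single; exists s.
by move: FU; rewrite Ft_point rpredZeq (negbTE Ft).
Qed.

Lemma invariant_point_u x : X x -> point x \in U -> point u \in U.
Proof.
move: x; apply: coset_weights_raise => // x i xX xiX xi IH xU; apply: IH.
by rewrite -shift_point //; case: (invariant_apply i xU).
Qed.

Lemma invariant_point_all : point u \in U -> forall x, X x -> point x \in U.
Proof.
move=> uU; apply: coset_weights_raise => // x i xX xiX xi xiU.
have -> : x = x + S i + (- S i) by rewrite addrK.
rewrite -shift_point ?addrK //; by case: (invariant_apply i xiU).
Qed.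

End InvariantSubspace.

(** An invariant subspace that is not zero contains a point mass, hence the one at
    [u] by raising, hence all of them by lowering. *)
Lemma coset_weights_minuscule : u != 0 -> minuscule_weight G S u.
Proof.
move=> u0; exists V, diag, (fun i => shift (S i)), (fun i => shift (- S i)).
have uX := coset_weights_self.
have point_weight x : X x -> weight_vector G S diag x (point x).
  by move=> xX i; rewrite diag_point // pairing_coroot ?SP.
split; first split.
- exact: coset_weights_representation.
- split=> [|U U_inv].
    rewrite dimv_eq0; apply/eqP => V0; have := memvf (point u).
    by rewrite V0 memv0 (negbTE (point_neq0 uX)).
  have [->|[F [FU F0]]] : U = 0%VS \/ exists F, F \in U /\ F != 0.
  + have [->|U0] := eqVneq U 0%VS; [by left | right].
    by exists (vpick U); rewrite memv_pick vpick0.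
  + by left.
  right; have [x xX xU] := invariant_contains_point U_inv FU F0.
  have uU := invariant_point_u U_inv xX xU.
  apply/eqP; rewrite eqEsubv subvf; apply/subvP => H _; rewrite (point_sum H).
  by apply: memv_suml => t _; apply: rpredZ; apply: invariant_point_all => //;
    exact: index_weight.
- have [i ui] : exists i, '[u, S i] != 0.
    apply: contrapT => h; case/eqP: u0; apply: (simple_separates hG hS) => i.
    by rewrite ip0l; apply: contrapT => /eqP e; apply: h; exists i.
  exists i; apply/orP; left; apply/eqP => /lfunP/(_ (point u)).
  rewrite diag_point // zero_lfunE => /eqP; rewrite scaler_eq0 (negbTE (point_neq0 uX)).
  by rewrite orbF fmorph_eq0 (negbTE ui).
- exists u; rewrite -coset_weightsE; apply/seteqP; split=> [x [F F0 xF]|x xX].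
    have [t Ft] : exists t, (F : {ffun T -> C}) t != 0.
      apply: contrapT => h; case/eqP: F0; apply/ffunP => t; rewrite ffunE.
      by apply: contrapT => /eqP Ft; apply: h; exists t.
    suff -> : x = val t by exact: index_weight.
    apply: (simple_separates hG hS) => i; have := congr1 (extend^~ (val t)) (xF i).
    rewrite diagE; last exact: index_weight.
    rewrite extendZ extend_val pairing_coroot ?SP // => /(mulIf Ft).
    by case.
  by exists (point x); [exact: point_neq0 | exact: point_weight].
exists (point u); split; [exact: point_neq0 | exact: point_weight | move=> i].
apply: extend_inj => x xX; rewrite shiftE // extend0.
have [xiX|/extend_out-> //] := pselect (X (x - S i)).
rewrite extend_point //; case: eqP => // xi.
have := (coset_weights_sub xX (SP i)).1 xiX.
have -> : x = u + S i by rewrite -xi subrK.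
rewrite ipDl (root_norm hG (SP i)) => ui; have ui0 := u_dom i.
by exfalso; clear -ui ui0; lra.
Qed.

End MinusculeRepresentation.

(** * Summation along fibres of constant size *)

Section FiberSum.
Variables (A : finType) (T : choiceType) (m : A -> T).
Variables (B : {set A}) (Q : set T) (n : nat).
Hypothesis mB : forall k, k \in B -> Q (m k).
Hypothesis Bm : forall u, Q u -> exists2 k, k \in B & m k = u.
Hypothesis fiber_card : forall k, k \in B -> #|[set l in B | m l == m k]| = n.

Lemma fiber_base_finite : finite_set Q.
Proof.
apply: (@sub_finite_set _ _ (m @` [set: A])); last exact: finite_image.
by move=> u /Bm[k _ <-]; exists k.
Qed.

Lemma fiber_sum (C : nmodType) (F : T -> C) : \sum_(k in B) F (m k) = (\sum_(u \in Q) F u) *+ n.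
Proof.
rewrite fsbig_finite /=; last exact: fiber_base_finite.
rewrite -sumrMnl; transitivity
    (\sum_(u <- fset_set Q) \sum_(k in B) if m k == u then F u else 0).
  rewrite exchange_big /=; apply: eq_bigr => k kB.
  have mkQ : m k \in fset_set Q.
    by rewrite in_fset_set ?inE; [exact: mB | exact: fiber_base_finite].
  rewrite (bigD1_seq (m k)) //= eqxx big1 ?addr0 // => u.
  by rewrite eq_sym => /negbTE ->.
rewrite !big_seq; apply: eq_bigr => u.
rewrite in_fset_set; last exact: fiber_base_finite.
rewrite inE => /Bm[k kB <-]; rewrite -big_mkcondr /= -(fiber_card kB) -sumr_const.
by apply: eq_bigl => l; rewrite inE.
Qed.

Lemma fiber_count : #|B| = (#|` fset_set Q| * n)%N.
Proof.
rewrite -sum1_card (fiber_sum (fun=> 1%N)) fsbig_finite; last exact: fiber_base_finite.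
rewrite big_const_seq count_predT iter_addr_0.
by rewrite -[1%N *+ _]/(_%:R) natn -mulr_natr natn.
Qed.

End FiberSum.

(** * Orthogonal frames in the root lattice *)

Section OrthogonalFrame.
Variables (R : realType) (r : nat) (G : group_datum R r).
Hypothesis hG : compact_simple_simply_laced G.
Local Notation "''[' u , v ]" := (ip G u v).
Local Notation Lambda := (root_lattice G).

(** [r] mutually orthogonal vectors of the root lattice: on the sublattice of
    finite index which they span, the quadratic form is diagonal.  The number
    [n.+2] is a common multiple of their square lengths [a i]. *)
Definition orthogonal_frame (v : 'I_r -> 'rV[R]_r) (a : 'I_r -> nat) (n : nat) :=
  [/\ forall i, Lambda (v i),
      forall i j, '[v i, v j] = if i == j then (a i)%:R else 0,
      forall i, (0 < a i)%N && ~~ odd (a i) &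
      forall i, (a i %| n.+2)%N].

Lemma lattice_scale (z : R) u : z \is a Num.int -> Lambda u -> Lambda (z *: u).
Proof. by move=> /intrP[m ->] uL; rewrite scaler_int; apply: int_spanMz. Qed.

Lemma lattice_norm_even_nat u : Lambda u -> u != 0 ->
  exists a : nat, [/\ (0 < a)%N, ~~ odd a & '[u, u] = a%:R].
Proof.
move=> uL u0; have [x /intrP[m ->] uE] := lattice_even hG uL.
have := ip_gt0 hG u0; rewrite uE pmulr_rgt0 // ltr0z; case: m uE => // m uE m0.
exists (2 * m)%N; rewrite natrM; split=> //; last by rewrite oddM.
by rewrite muln_gt0.
Qed.

(** Gram-Schmidt orthogonalisation with the denominators cleared. *)
Lemma orthogonal_seq k : (k <= r)%N ->
  exists s : seq 'rV[R]_r, [/\ size s = k, uniq s,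
    {in s, forall u, Lambda u /\ u != 0} &
    {in s &, forall u v, u != v -> '[u, v] = 0}].
Proof.
elim: k => [_|k IH kr]; first by exists [::].
have [s [sk s_uniq sL orth]] := IH (ltnW kr).
have [a aP as_notin] : exists2 a, a \in root_seq G & a \notin << s >>%VS.
  apply: contrapT => h; have : (fullv <= << s >>)%VS.
    apply/subvP => u _; apply: (subvP _ u (root_span hG u)); apply/span_subvP => a aP.
    by apply: contrapT => /negP as'; apply: h; exists a.
  move/dimvS; rewrite dimvf dim_matrix mul1r => rs.
  by have := leq_trans rs (dim_span s); rewrite sk leqNgt kr.
pose d := \prod_(v <- s) '[v, v].
have d0 : d != 0.
  rewrite /d prodf_seq_neq0; apply/allP => v vs /=.
  by rewrite gt_eqF // ip_gt0 //; case: (sL v vs).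
pose w := d *: a - \sum_(v <- s) (d / '[v, v] * '[a, v]) *: v.
have aL := lattice_root aP.
have norm_int v : v \in s -> '[v, v] \is a Num.int.
  by move=> /sL[vL _]; apply: weight_lattice => //; apply: lattice_weight.
have d_int : d \is a Num.int.
  by rewrite /d big_seq; apply: rpred_prod => v; apply: norm_int.
have wL : Lambda w.
  apply: int_spanB; first exact: lattice_scale.
  rewrite big_seq; apply: int_span_sum => v vs.
  have [vL v0] := sL v vs; apply: lattice_scale => //.
  apply: rpredM; last by apply: weight_lattice => //; apply: lattice_weight.
  rewrite /d (perm_big _ (perm_to_rem vs)) big_cons mulrAC divff ?mul1r; last first.
    by rewrite gt_eqF // ip_gt0.
  by rewrite big_seq; apply: rpred_prod => x /mem_rem; apply: norm_int.
have w0 : w != 0.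
  apply: contraNneq as_notin => /eqP; rewrite subr_eq0 => /eqP da.
  rewrite -[a]scale1r -(mulVf d0) -scalerA da; apply: rpredZ.
  by rewrite big_seq; apply: rpred_sum => v vs; apply: rpredZ; apply: memv_span.
have w_orth u : u \in s -> '[w, u] = 0.
  move=> us; have u_norm : '[u, u] != 0.
    by rewrite gt_eqF // ip_gt0 //; case: (sL u us).
  rewrite ipBl ipZl ip_suml (bigD1_seq u) //= big1_seq => [|v /andP[vu vs]].
    by rewrite ipZl addr0 mulrAC divfK // subrr.
  by rewrite ipZl (orth v u) ?mulr0.
exists (w :: s); split=> [|||u v].
- by rewrite /= sk.
- rewrite /= s_uniq andbT; apply/negP => /w_orth/eqP.
  by rewrite gt_eqF // ip_gt0.
- by move=> u; rewrite in_cons => /predU1P[->//|]; apply: sL.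
rewrite !in_cons => /predU1P[->|us] /predU1P[->|vs]; rewrite ?eqxx //.
- by rewrite w_orth.
- by rewrite ipC // w_orth.
- exact: orth.
Qed.

Lemma orthogonal_frame_exists : exists v a n, orthogonal_frame v a n.
Proof.
have [s [sr s_uniq sL orth]] := orthogonal_seq (leqnn r).
have s_in (i : 'I_r) : nth 0 s i \in s by rewrite mem_nth ?sr.
have norm_nat (i : 'I_r) : exists a : nat,
    [/\ (0 < a)%N, ~~ odd a & '[nth 0 s i, nth 0 s i] = a%:R].
  by have [vL v0] := sL _ (s_in i); apply: lattice_norm_even_nat.
have [a ha] := boolp.choice norm_nat.
pose N := (2 * \prod_i a i)%N.
have N2 : (2 <= N)%N.
  rewrite /N -{1}[2%N]muln1 leq_pmul2l // prodn_gt0 // => i.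
  by have [] := ha i.
exists (fun i => nth 0 s i), a, N.-2; split=> [i|i j|i|i].
- by case: (sL _ (s_in i)).
- case: eqVneq => [->|ij]; first by have [_ _ ->] := ha j.
  by apply: orth; rewrite ?s_in // nth_uniq ?sr.
- by have [-> -> _] := ha i.
have -> : (N.-2.+2 = N)%N by lia.
by rewrite /N (bigD1 i) //= mulnCA dvdn_mulr.
Qed.

End OrthogonalFrame.

(** * A finite model of the lattices dual to a frame *)

Section FiniteModel.
Variables (R : realType) (r : nat) (G : group_datum R r).
Hypothesis hG : compact_simple_simply_laced G.
Variables (v : 'I_r -> 'rV[R]_r) (a : 'I_r -> nat) (n : nat).
Hypothesis frame : orthogonal_frame G v a n.

Local Notation "''[' x , y ]" := (ip G x y).
Local Notation Lambda := (root_lattice G).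
Local Notation A := 'rV['I_n.+2]_r.
Implicit Types (x y : 'rV[R]_r) (k l : A) (H L : set 'rV[R]_r).

Let vL i : Lambda (v i). Proof. by case: frame. Qed.

Let v_ip i j : '[v i, v j] = if i == j then (a i)%:R else 0.
Proof. by case: frame. Qed.

Let aR i : (a i)%:R != 0 :> R.
Proof. by rewrite pnatr_eq0 -lt0n; case: frame => _ _ /(_ i)/andP[]. Qed.

Let a_dvd i : (a i %| n.+2)%N. Proof. by case: frame. Qed.

Definition frame_lattice : set 'rV[R]_r := int_span [seq v i | i <- enum 'I_r].
Local Notation D := frame_lattice.

Lemma frame_in_lattice i : D (v i).
Proof. by apply: int_span_mem; apply: map_f; rewrite mem_enum. Qed.

Lemma frame_lattice_sub x : D x -> Lambda x.
Proof.
move: x; apply: int_span_ind => [|x y|]; [exact: int_span0 | exact: int_spanB |].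
by move=> _ /mapP[i _ ->].
Qed.

(** The matrix of the frame is invertible, since its Gram matrix is diagonal with
    nonzero entries. *)
Lemma frame_expansion x : x = \sum_i ('[x, v i] / (a i)%:R) *: v i.
Proof.
pose M := \matrix_i v i.
have MGM : M *m gram G *m M^T = diag_mx (\row_i (a i)%:R).
  apply/matrixP => i j; rewrite [RHS]mxE [X in X *+ _]mxE [LHS]mxE.
  transitivity '[v i, v j]; last by rewrite v_ip; case: eqP.
  rewrite /ip /pairing mulmxA mxE; apply: eq_bigr => p _; rewrite !mxE; congr (_ * _).
  by apply: eq_bigr => q _; rewrite !mxE.
have MG_unit : M *m gram G \in unitmx.
  have : M *m gram G *m M^T \in unitmx.
    rewrite MGM unitmxE det_diag unitfE; apply/prodf_neq0 => i _.
    by rewrite mxE.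
  by rewrite unitmx_mul => /andP[].
apply/eqP; rewrite -subr_eq0; set y := x - _.
have y0 i : '[v i, y] = 0.
  rewrite (ipC hG) /y ipBl ip_suml (bigD1 i) //= big1 => [|j ji].
    by rewrite ipZl v_ip eqxx addr0 divfK // subrr.
  by rewrite ipZl v_ip (negbTE ji) mulr0.
have : M *m gram G *m y^T = 0.
  apply/matrixP => i j; rewrite ord1 [RHS]mxE -[RHS](y0 i) /ip /pairing mulmxA !mxE.
  apply: eq_bigr => p _; rewrite !mxE; congr (_ * _).
  by apply: eq_bigr => q _; rewrite !mxE.
move/(congr1 (mulmx (invmx (M *m gram G)))); rewrite mulKmx // mulmx0.
by move/(congr1 trmx); rewrite trmxK trmx0 => ->.
Qed.

Definition frame_dual x := forall i, '[x, v i] \is a Num.int.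

Lemma weight_frame_dual x : weight G x -> frame_dual x.
Proof. by move=> wx i; apply: weight_lattice. Qed.

Lemma frame_dual_ip x y : frame_dual x -> D y -> '[x, y] \is a Num.int.
Proof.
move=> dx; move: y; apply: int_span_ind => [|y z xy xz|_ /mapP[i _ ->]] //.
  by rewrite ip0r.
by rewrite (ipBr hG) rpredB.
Qed.

(** In the expansion along the frame the coefficients are then integers. *)
Lemma frame_latticeP x :
  (forall i, exists2 z : R, z \is a Num.int & '[x, v i] = (a i)%:R * z) -> D x.
Proof.
move=> xv; rewrite (frame_expansion x); apply: int_span_sum => i _.
have [z /intrP[m ->] ->] := xv i; rewrite mulrAC divff // mul1r scaler_int.
by apply: int_spanMz; exact: frame_in_lattice.
Qed.

(** [k] represents the coset of [frame_point k] in the quotient of the lattice dual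
    to the frame by the frame lattice; reduction modulo [n.+2] keeps the coset. *)
Definition frame_point k : 'rV[R]_r := \sum_i ((k 0 i : nat)%:R / (a i)%:R) *: v i.
Local Notation phi := frame_point.

Lemma frame_point_ip k i : '[phi k, v i] = (k 0 i : nat)%:R.
Proof.
rewrite ip_suml (bigD1 i) //= big1 ?addr0 => [|j ji].
  by rewrite ipZl v_ip eqxx divfK.
by rewrite ipZl v_ip (negbTE ji) mulr0.
Qed.

Lemma frame_point_dual k : frame_dual (phi k).
Proof. by move=> i; rewrite frame_point_ip rpred_nat. Qed.

Lemma frame_point_norm k :
  '[phi k, phi k] = \sum_i (k 0 i : nat)%:R ^+ 2 / (a i)%:R.
Proof.
rewrite {2}/phi (ip_sumr hG); apply: eq_bigr => i _.
by rewrite (ipZr hG) frame_point_ip mulrAC expr2.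
Qed.

Lemma frame_modulus i : exists m : nat, (n.+2)%:R = (a i)%:R * m%:R :> R.
Proof. by have /dvdnP[m ->] := a_dvd i; exists m; rewrite natrM mulrC. Qed.

Lemma frame_pointD k l : D (phi (k + l) - (phi k + phi l)).
Proof.
apply: frame_latticeP => i; have [m mE] := frame_modulus i.
pose c : nat := k 0 i; pose d : nat := l 0 i.
exists (- ((c + d) %/ n.+2)%N%:R * m%:R); first by rewrite rpredM ?rpredN ?rpred_nat.
rewrite ipBl ipDl !frame_point_ip mxE -/c -/d.
have -> : ((k 0 i + l 0 i)%R : nat) = ((c + d) %% n.+2)%N by [].
by rewrite -natrD {2}(divn_eq (c + d) n.+2) natrD natrM mE; ring.
Qed.

Lemma frame_point0 : phi 0 = 0.
Proof. by rewrite /phi big1 // => i _; rewrite mxE /= mul0r scale0r. Qed.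

Lemma frame_pointB k l : D (phi (k - l) - (phi k - phi l)).
Proof.
have := int_spanN (frame_pointD (k - l) l); rewrite subrK opprB.
by congr D; rewrite opprB !addrA addrC; congr (_ + _); rewrite addrC.
Qed.

Lemma frame_point_surj x : frame_dual x -> exists k, D (x - phi k).
Proof.
move=> dx; pose z i := Num.floor '[x, v i].
exists (\row_i inord (absz (z i %% n.+2)%Z)); apply: frame_latticeP => i.
have [m mE] := frame_modulus i.
exists ((z i %/ n.+2)%Z%:~R * m%:R); first by rewrite rpredM ?rpred_nat ?intr_int.
have zE : '[x, v i] = (z i)%:~R by rewrite /z floorK.
have zm := modz_ge0 (z i) (isT : n.+2%:Z != 0).
rewrite ipBl frame_point_ip mxE inordK; last first.
  by rewrite -ltz_nat gez0_abs // ltz_pmod.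
have -> : (absz (z i %% n.+2)%Z)%:R = (z i %% n.+2)%Z%:~R :> R.
  by rewrite -[in RHS](gez0_abs zm).
by rewrite zE {1}(divz_eq (z i) n.+2) intrD intrM -pmulrn mE; ring.
Qed.

(** Lattices between the frame lattice and its dual become subgroups of the model,
    and indices of lattices become quotients of cardinals. *)
Definition model H : {set A} := [set k | `[< H (phi k) >]].

Definition between H :=
  [/\ forall x y, H x -> H y -> H (x - y), forall x, D x -> H x &
      forall x, H x -> frame_dual x].

Lemma modelP H k : reflect (H (phi k)) (k \in model H).
Proof. by rewrite inE; apply: asboolP. Qed.

Lemma between0 H : between H -> H 0.
Proof. by case=> _ h _; apply: h; exact: int_span0. Qed.

Lemma betweenD H x y : between H -> H x -> H y -> H (x + y).
Proof.
move=> bH Hx Hy; case: (bH) => HB _ _; rewrite -[y]opprK; apply: (HB) => //.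
by rewrite -[- y]add0r; apply: HB => //; exact: between0.
Qed.

Lemma model_subgroup H : between H -> subgroup (model H).
Proof.
move=> bH; case: (bH) => HB HD _; split.
  by apply/modelP; rewrite frame_point0; exact: between0.
move=> k l /modelP Hk /modelP Hl; apply/modelP.
rewrite -(subrK (phi k - phi l) (phi (k - l))); apply: betweenD => //.
  by apply: HD; exact: frame_pointB.
exact: HB.
Qed.

Definition model_form k : R[i] := expi (pi * '[phi k, phi k]).
Definition model_pairing k l : R[i] := expi (2 * pi * '[phi k, phi l]).
Local Notation q := model_form.
Local Notation b := model_pairing.

Lemma form_lattice_translate x y : frame_dual x -> D y ->
  expi (pi * '[x + y, x + y]) = expi (pi * '[x, x]).
Proof.
move=> dx Dy; have [m m_int yE] := lattice_even hG (frame_lattice_sub Dy).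
rewrite !(ipDl, ipDr) // (ipC hG y x) yE.
have -> : pi * ('[x, x] + '[x, y] + ('[x, y] + 2 * m)) =
  pi * '[x, x] + 2 * pi * ('[x, y] + m) by ring.
by rewrite expiD expi_2pi_int ?mulr1 // rpredD // frame_dual_ip.
Qed.

Lemma frame_dualD x y : frame_dual x -> frame_dual y -> frame_dual (x + y).
Proof. by move=> dx dy i; rewrite ipDl rpredD. Qed.

Lemma model_formD k l : q (k + l) = q k * q l * b k l.
Proof.
rewrite /q -(subrK (phi k + phi l) (phi (k + l))) addrC form_lattice_translate.
- rewrite -!expiD; congr expi; rewrite !(ipDl, ipDr) // (ipC hG (phi l)); ring.
- by apply: frame_dualD; exact: frame_point_dual.
- exact: frame_pointD.
Qed.

Lemma model_form_unit k : q k * (q k)^*%R = 1.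
Proof. exact: expi_conjM. Qed.

Lemma model_pairingC k l : b k l = b l k.
Proof. by rewrite /b (ipC hG). Qed.

Lemma model_pairingD k l m : b k (l + m) = b k l * b k m.
Proof.
have d_int := frame_dual_ip (frame_point_dual k) (frame_pointD l m).
rewrite /b -(subrK (phi l + phi m) (phi (l + m))) (ipDr hG) mulrDr.
by rewrite expiD (expi_2pi_int d_int) mul1r (ipDr hG (phi k) (phi l)) mulrDr expiD.
Qed.

Lemma pairing_eq1 k l : b k l = 1 <-> '[phi k, phi l] \is a Num.int.
Proof. by split; [exact: expi_2pi_eq1 | exact: expi_2pi_int]. Qed.

(** Orthogonality in the model is integrality of inner products, so orthogonal
    complements come from dual lattices. *)
Lemma model_perp H : between H ->
  perp b (model H) = model [set x | forall y, H y -> '[x, y] \is a Num.int].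
Proof.
move=> [HB HD Hdual]; apply/setP => k; apply/perpP/modelP => [kH y Hy|kH l /modelP Hl].
  have [l yl] := frame_point_surj (Hdual y Hy).
  rewrite -(subrK (phi l) y) (ipDr hG); apply: rpredD.
    by apply: frame_dual_ip => //; exact: frame_point_dual.
  apply/pairing_eq1/kH/modelP; rewrite -(subKr y (phi l)).
  by apply: (HB) => //; apply: HD.
by apply/pairing_eq1; apply: kH.
Qed.

(** Pairing with [v i / a i] shows that the coordinate of [k] along [v i] is
    divisible by [a i]. *)
Lemma model_perp_full k : k \in perp b [set: A]%SET -> D (phi k).
Proof.
move/perpP => kA; apply: frame_latticeP => i.
pose l : A := \row_j (if j == i then 1 else 0)%:R.
have li : phi l = (a i)%:R^-1 *: v i.
  rewrite /phi (bigD1 i) //= big1 ?addr0 => [|j ji].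
    by rewrite !mxE eqxx /= mul1r.
  by rewrite !mxE (negbTE ji) /= mul0r scale0r.
have /pairing_eq1 : b k l = 1 by apply: kA; rewrite inE.
rewrite li (ipZr hG) => kl; exists ((a i)%:R^-1 * '[phi k, v i]) => //.
by rewrite mulrA divff // mul1r.
Qed.

Lemma model_form_lattice k : Lambda (phi k) -> q k = 1.
Proof. by move=> /(lattice_even hG)[x x_int xE]; apply: expi_pi_even xE. Qed.

End FiniteModel.

(** * Gauss sums and orders of centres in the finite model *)

Section ModelGaussSum.
Variables (R : realType) (r : nat) (G : group_datum R r).
Hypothesis hG : compact_simple_simply_laced G.
Variables (v : 'I_r -> 'rV[R]_r) (a : 'I_r -> nat) (n : nat).
Hypothesis frame : orthogonal_frame G v a n.

Local Notation "''[' x , y ]" := (ip G x y).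
Local Notation Lambda := (root_lattice G).
Local Notation A := 'rV['I_n.+2]_r.
Local Notation phi := (@frame_point R r v a n).
Local Notation q := (@model_form R r G v a n).
Local Notation model := (@model R r v a n).
Implicit Types (k l : A) (H L : set 'rV[R]_r).

(** The form is diagonal on the model, so its Gauss sum is a product of
    one-dimensional ones. *)
Lemma model_gauss_sum_arg : has_arg (\sum_k q k) (pi / 4 * r%:R).
Proof.
pose F (i : 'I_r) (j : 'I_n.+2) : R[i] := expi (pi * ((j : nat)%:R ^+ 2 / (a i)%:R)).
have -> : \sum_k q k = \prod_i \sum_j F i j.
  rewrite bigA_distr_bigA /=.
  pose g (f : {ffun 'I_r -> 'I_n.+2}) : A := \row_i f i.
  pose g' (k : A) : {ffun 'I_r -> 'I_n.+2} := [ffun i => k 0 i].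
  rewrite (reindex g) /=; last first.
    exists g' => [f _|k _]; first by apply/ffunP => i; rewrite ffunE mxE.
    by apply/rowP => i; rewrite mxE ffunE.
  apply: eq_bigr => f _; rewrite /model_form (frame_point_norm hG frame) mulr_sumr.
  rewrite (big_morph (@expi R) (@expiD R) (@expi0 R)).
  by apply: eq_bigr => i _; rewrite mxE.
have -> : pi / 4 * r%:R = \sum_(i < r) pi / 4 :> R.
  by rewrite sumr_const card_ord mulr_natr.
apply: has_arg_prod => i _; case: frame => _ _ /(_ i)/andP[a0 aev] /(_ i)/dvdnP[m nE].
have := @gauss_sum_periods_arg R (a i) m a0 aev.
by rewrite mulnC -nE big_mkord; apply; case: m nE.
Qed.

(** The cosets of [L] in [H] are translates of each other. *)
Lemma model_coset_card H L k : between G v H -> between G v L -> L `<=` H ->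
  k \in model H ->
  #|[set l in model H | `[< L (phi l - phi k) >]]| = #|model L|.
Proof.
move=> bH bL LH kH; rewrite -[RHS](card_imset _ (addIr k)); apply: eq_card => l.
have [_ LD _] := bL; have [LB _ _] := bL; have [HB HD _] := bH.
have translate x y : phi (x + y) - phi y = (phi (x + y) - (phi x + phi y)) + phi x.
  by rewrite opprD addrA addrAC subrK.
apply/idP/imsetP => [|[x /modelP xL ->]].
  rewrite !inE => /andP[_ /asboolP lk]; exists (l - k); last by rewrite subrK.
  apply/modelP; rewrite -(subrK (phi l - phi k) (phi (l - k))).
  by apply: (betweenD bL) => //; apply: LD; exact: (frame_pointB hG frame).
have xkL : L (phi (x + k) - phi k).
  by rewrite translate; apply: (betweenD bL) => //; apply: LD; exact: (frame_pointD hG frame).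
rewrite inE; apply/andP; split; last exact/asboolP.
apply/modelP; rewrite -(subrK (phi k) (phi (x + k))).
by apply: (betweenD bH); [exact: LH | exact/modelP].
Qed.

Lemma between_lattice : between G v Lambda.
Proof.
split; [exact: int_spanB | exact: (frame_lattice_sub frame) |].
by move=> x /(lattice_weight hG); apply: (weight_frame_dual hG frame).
Qed.

Lemma between_weight : between G v (weight G).
Proof.
split; [exact: weightB | |].
  by move=> x /(frame_lattice_sub frame)/(lattice_weight hG).
by move=> x; apply: (weight_frame_dual hG frame).
Qed.

Variable S : 'I_r -> 'rV[R]_r.
Hypothesis hS : simple_roots G S.

Lemma minuscule_algebraE :
  minuscule_algebra G S = [set u | small G u /\ dominant G S u].
Proof.
apply/seteqP; split=> [u [->|]|u [su du]].
- by split=> [|i]; [split=> x _ /= | ]; rewrite ip0l ?rpred0 ?normr0.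
- exact: (minuscule_weight_small hG hS).
- have [->|u0] := eqVneq u 0; [by left | right].
  exact: (coset_weights_minuscule hG hS su du u0).
Qed.

(** The minuscule weights represent the cosets of the root lattice in a lattice of
    weights, and the form is constant on cosets modulo the root lattice. *)
Lemma sum_minuscule H : between G v H -> Lambda `<=` H -> H `<=` weight G ->
  \sum_(k in model H) q k =
  (\sum_(u \in minuscule_algebra G S `&` H) expi (pi * '[u, u])) *+ #|model Lambda|.
Proof.
move=> bH LH HW; have [HB HD Hdual] := bH.
have rep k : exists u, k \in model H ->
    [/\ small G u, dominant G S u & Lambda (phi k - u)].
  have [/modelP/HW kH|kH] := boolP (k \in model H); last by exists 0.
  by have [u hu] := coset_representative hG hS kH; exists u.
have [m hm] := boolp.choice rep.
rewrite minuscule_algebraE.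
have LN x y : Lambda (x - y) -> Lambda (y - x).
  by move=> /int_spanN; rewrite opprB.
have LT x y z : Lambda (x - y) -> Lambda (y - z) -> Lambda (x - z).
  by move=> xy yz; rewrite -(subrK y x) -addrA; apply: int_spanD.
have mH k : k \in model H -> H (m k).
  move=> kH; have [_ _ /LH h] := hm k kH; rewrite -(subKr (phi k) (m k)).
  by apply: (HB) => //; exact/modelP.
transitivity (\sum_(k in model H) expi (pi * '[m k, m k])); last first.
  apply: (fiber_sum (m := m) _ _ _ (fun u => expi (pi * '[u, u])))
    => [k kH|u [[su du] Hu]|k kH].
  - by have [sm dm _] := hm k kH; split; [split | exact: mH].
  - have [k Dk] := frame_point_surj hG frame (Hdual u Hu).
    have kH : k \in model H.
      by apply/modelP; rewrite -(subKr u (phi k)); apply: HB => //; apply: HD.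
    exists k => //; have [sm dm kL] := hm k kH.
    apply: (small_dominant_unique hG hS) => //; apply: (LT _ (phi k)); first exact: LN.
    by apply: LN; exact: (frame_lattice_sub frame).
  - rewrite -(model_coset_card bH between_lattice LH kH); apply: eq_card => l.
    rewrite !inE; case lH: `[< H (phi l) >] => //=; rewrite -[H _]/(H _) in lH.
    have {}lH : l \in model H by rewrite inE.
    have [sk dk kL] := hm k kH; have [sl dl lL] := hm l lH.
    apply/eqP/asboolP => [lk|lk].
      by apply: (LT _ (m k)); [rewrite -lk | apply: LN].
    apply: (small_dominant_unique hG hS) => //.
    by apply: (LT _ (phi l)); [apply: LN | apply: (LT _ (phi k))].
apply: eq_bigr => k kH; have [sm _ kL] := hm k kH; rewrite /model_form.
have [x x_int xE] := lattice_even hG kL; set d := phi k - m k in kL xE.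
have dE : phi k = d + m k by rewrite subrK.
clearbody d; rewrite dE {dE}.
rewrite !(ipDl, ipDr) // xE (ipC hG (m k)).
have -> : pi * (2 * x + '[d, m k] + ('[d, m k] + '[m k, m k])) =
  2 * pi * (x + '[d, m k]) + pi * '[m k, m k] by ring.
rewrite expiD expi_2pi_int ?mul1r // rpredD // (ipC hG).
by apply: weight_lattice => //; case: sm.
Qed.

(** The lattice of the torus, moved to the space of weights by the inner
    product. *)
Definition row_of_torus : set 'rV[R]_r := [set u | lattice G (gram G *m u^T)].

Lemma gram_unit : gram G \in unitmx.
Proof.
rewrite -row_free_unit; apply/inj_row_free => x x0; apply: (ip_le0 hG).
by rewrite /ip /pairing mulmxA x0 mul0mx mxE.
Qed.

Lemma gram_row (x : 'cV[R]_r) : exists u, gram G *m u^T = x.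
Proof. by exists (invmx (gram G) *m x)^T; rewrite trmxK mulKVmx // gram_unit. Qed.

Lemma coweight_row u : coweight_lattice G (gram G *m u^T) <-> weight G u.
Proof.
split=> [h a0 a0P|wu x xL].
  by rewrite (ipC hG); apply: h; exact: lattice_root.
by rewrite -/(ip G x u) (ipC hG); apply: weight_lattice.
Qed.

Lemma between_torus : between G v row_of_torus.
Proof.
have [_ _ _ [l0 lB cl lc]] := hG.
split=> [x y hx hy|x xD|x /lc/coweight_row]; rewrite /row_of_torus /=.
- by rewrite linearB /= mulmxBr; apply: lB.
- move: x xD; apply: int_span_ind => [|x y hx hy|].
  + by rewrite trmx0 mulmx0.
  + by rewrite linearB /= mulmxBr; apply: lB.
  move=> _ /mapP[i _ ->]; case: frame => /(_ i) + _ _ _; move: (v i).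
  apply: int_span_ind => [|x y hx hy|x xP].
  + by rewrite trmx0 mulmx0.
  + by rewrite linearB /= mulmxBr; apply: lB.
  apply: cl; apply: int_span_mem; apply/mapP; exists x => //.
  by rewrite /coroot root_norm // divff ?pnatr_eq0 // scale1r.
- exact: (weight_frame_dual hG frame).
Qed.

Lemma order_center_model :
  #|model (weight G)| = (order_center G * #|model row_of_torus|)%N.
Proof.
have [_ _ _ [l0 lB cl lc]] := hG; have bT := between_torus.
pose m k : set 'cV[R]_r := [set gram G *m (phi k)^T + y | y in lattice G].
have mP x y : [set x + z | z in lattice G] = [set y + z | z in lattice G] <->
    lattice G (x - y).
  have lN z : lattice G z -> lattice G (- z).
    by move=> lz; rewrite -[- z]add0r; apply: lB.
  split=> [xy|xy].
    have : [set x + z | z in lattice G] x by exists 0; rewrite ?addr0.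
    by rewrite xy => -[z lz <-]; rewrite addrC addKr.
  apply/seteqP; split=> _ [z lz <-].
    exists (x - y + z); last by rewrite addrA (addrC y) subrK.
    by rewrite -[z]opprK; apply: lB => //; apply: lN.
  exists (z - (x - y)); first exact: lB.
  by rewrite opprB addrCA (addrC x) subrK addrC.
rewrite /order_center; apply: (fiber_count (m := m)) => [k /modelP/coweight_row kW|_ [x xW <-]|k kW].
- by exists (gram G *m (phi k)^T).
- have [u uE] := gram_row x; have uW : weight G u by apply/coweight_row; rewrite uE.
  have [k kD] := frame_point_surj hG frame (weight_frame_dual hG frame uW).
  have kL := frame_lattice_sub frame kD.
  exists k; first by apply/modelP; rewrite -(subKr u (phi k)); apply: weightB => //;
    apply: lattice_weight.
  apply/mP; rewrite -uE -mulmxBr -linearB /=; case: bT => TB TD _.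
  by rewrite -[_ - u]opprB linearN /= mulmxN -[- _]add0r; apply: lB => //; apply: TD.
rewrite -(model_coset_card between_weight bT _ kW); last by move=> x /lc/coweight_row.
apply: eq_card => l; rewrite !inE; congr (_ && _).
apply/eqP/asboolP => [/mP|h]; first by rewrite -mulmxBr -linearB.
by apply/mP; rewrite -mulmxBr -linearB.
Qed.

End ModelGaussSum.

(** * The Langlands dual and the universal cover in the same model *)

Section LanglandsDual.
Variables (R : realType) (r : nat) (G : group_datum R r).
Hypothesis hG : compact_simple_simply_laced G.
Variables (v : 'I_r -> 'rV[R]_r) (a : 'I_r -> nat) (n : nat).
Hypothesis frame : orthogonal_frame G v a n.

Local Notation "''[' x , y ]" := (ip G x y).
Local Notation Lambda := (root_lattice G).
Local Notation LG := (langlands_dual G).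
Local Notation L := (universal_cover G).
Local Notation A := 'rV['I_n.+2]_r.
Local Notation q := (@model_form R r G v a n).
Local Notation ellD := (dual_of_cols (lattice G)).
Implicit Types (x y : 'rV[R]_r) (k l : A).

Let gramK x : x *m gram G *m invmx (gram G) = x.
Proof. by rewrite mulmxK ?gram_unit. Qed.

Lemma ip_dual x y : ip LG (x *m gram G) (y *m gram G) = '[x, y].
Proof.
by rewrite /ip /pairing /= trmx_mul (gram_sym hG) -mulmxA mulKmx ?gram_unit.
Qed.

Lemma corootT b : b \in root_seq G -> (coroot G b)^T = b *m gram G.
Proof.
move=> bP; rewrite /coroot (root_norm hG bP) divff ?pnatr_eq0 // scale1r.
by rewrite trmx_mul trmxK gram_sym.
Qed.

Lemma dual_root_seq : root_seq LG = [seq b *m gram G | b <- root_seq G].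
Proof. by apply/eq_in_map => b; apply: corootT. Qed.

Lemma dual_root_lattice x : root_lattice LG (x *m gram G) <-> Lambda x.
Proof.
rewrite /root_lattice dual_root_seq; split=> [xL|].
  have := int_span_map (mulmxr (invmx (gram G))) xL; rewrite -map_comp /= gramK.
  by under eq_map => u do rewrite /= gramK; rewrite map_id.
exact: (int_span_map (mulmxr (gram G))).
Qed.

Lemma dual_frame : orthogonal_frame LG (fun i => v i *m gram G) a n.
Proof.
case: frame => vL v_ip a_pos a_dvd; split=> // i; first exact/dual_root_lattice.
by move=> j; rewrite ip_dual.
Qed.

Lemma dual_frame_point k :
  frame_point (fun i => v i *m gram G) a k = frame_point v a k *m gram G.
Proof. by rewrite /frame_point mulmx_suml; apply: eq_bigr => i _; rewrite scalemxAl. Qed.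

Lemma dual_model_form k : @model_form R r LG (fun i => v i *m gram G) a n k = q k.
Proof. by rewrite /model_form dual_frame_point ip_dual. Qed.

Lemma dual_model H :
  model (fun i => v i *m gram G) a n H = model v a n [set x | H (x *m gram G)].
Proof. by apply/setP => k; rewrite !inE dual_frame_point. Qed.

Lemma dual_weight x : weight LG (x *m gram G) <-> weight G x.
Proof.
rewrite /weight dual_root_seq; split=> wx b => [bP|/mapP[c cP ->]].
  by rewrite -ip_dual; apply: wx; apply: map_f.
by rewrite ip_dual; apply: wx.
Qed.

Lemma torus_dualE x : ellD x <-> forall y, row_of_torus G y -> '[x, y] \is a Num.int.
Proof.
split=> [xl y yl|xl z zl]; first exact: xl.
by have [y yE] := gram_row hG z; rewrite -yE; apply: xl; rewrite /row_of_torus /= yE.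
Qed.

Lemma torus_dual_dualE x : dual_of_cols (lattice LG) (x *m gram G) <->
  forall y, ellD y -> '[x, y] \is a Num.int.
Proof.
have pE z : pairing (x *m gram G) z = '[x, z^T].
  by rewrite /ip /pairing trmxK mulmxA.
split=> [xl y yl|xl z zl]; last by rewrite pE; apply: xl.
by rewrite -[y]trmxK -pE; apply: xl; rewrite /= trmxK.
Qed.

Lemma dual_row_of_torus x : row_of_torus LG (x *m gram G) <-> ellD x.
Proof.
by rewrite /row_of_torus /= trmx_mul trmxK trmx_inv (gram_sym hG) gramK.
Qed.

Lemma coroot_latticeE x : coroot_lattice G (gram G *m x^T) <-> Lambda x.
Proof.
have -> : gram G *m x^T = (x *m gram G)^T by rewrite trmx_mul (gram_sym hG).
rewrite -dual_root_lattice /root_lattice /coroot_lattice /=; split=> h.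
  by have /= := int_span_map trmx h; rewrite trmxK -map_comp.
have := int_span_map trmx h; rewrite -map_comp.
by under eq_map => u do rewrite /= trmxK.
Qed.

Lemma universal_cover_valid : compact_simple_simply_laced L.
Proof.
case: (hG) => h1 h2 h3 _; split=> //; split.
- exact: int_span0.
- exact: int_spanB.
- by [].
move=> z zL; have [y yE] := gram_row hG z; rewrite -yE in zL *.
by apply/(coweight_row hG)/(lattice_weight hG)/coroot_latticeE.
Qed.

End LanglandsDual.

(** * Reciprocity *)

Section Reciprocity.
Variables (R : realType) (r : nat) (G : group_datum R r).
Hypothesis hG : compact_simple_simply_laced G.
Variables (v : 'I_r -> 'rV[R]_r) (a : 'I_r -> nat) (n : nat).
Hypothesis frame : orthogonal_frame G v a n.

Local Notation "''[' x , y ]" := (ip G x y).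
Local Notation Lambda := (root_lattice G).
Local Notation A := 'rV['I_n.+2]_r.
Local Notation q := (@model_form R r G v a n).
Local Notation b := (@model_pairing R r G v a n).
Implicit Types (x y : 'rV[R]_r) (k l : A) (H : set 'rV[R]_r).

Definition lattice_dual H : set 'rV[R]_r :=
  [set x | forall y, H y -> '[x, y] \is a Num.int].

Let card_model := (#|A| * #|perp b [set: A]%SET|)%N.

Let perp_full_sub H : between G v H -> perp b [set: A]%SET \subset model v a n H.
Proof.
move=> [_ HD _]; apply/fintype.subsetP => k /(model_perp_full hG frame) kD.
by apply/modelP/HD.
Qed.

Lemma card_lattice_dual H : between G v H ->
  (#|model v a n H| * #|model v a n (lattice_dual H)| = card_model)%N.
Proof.
move=> bH; rewrite -(model_perp hG frame bH).
apply: (card_perp (model_pairingC hG v a (n := n)) (model_pairingD hG frame)).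
  exact: (model_subgroup hG frame bH).
exact: perp_full_sub.
Qed.

Lemma gauss_sum_lattice_dual H : between G v H ->
  (\sum_k q k) * (\sum_(k in model v a n H) q k)^*%R =
  #|model v a n H|%:R * \sum_(k in model v a n (lattice_dual H)) q k.
Proof.
move=> bH; rewrite -(model_perp hG frame bH).
apply: (gauss_sum_perp (model_formD hG frame) (@model_form_unit _ _ _ _ _ _)
  (model_pairingD hG frame)).
exact: (model_subgroup hG frame bH).
Qed.

Lemma model_gauss_sum : exists2 c : R, 0 < c /\ c ^+ 2 = card_model%:R &
  \sum_k q k = c%:C * expi (pi / 4 * r%:R).
Proof.
have [c c0 qc] := model_gauss_sum_arg hG frame; exists c => //; split=> //.
have := gauss_sum_perp (model_formD hG frame) (@model_form_unit _ _ _ _ _ _)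
  (model_pairingD hG frame) (subgroup_setT A).
have -> : \sum_(k in [set: A]%SET) q k = \sum_k q k.
  by apply: eq_bigl => k; rewrite inE.
have -> : \sum_(k in perp b [set: A]%SET) q k = #|perp b [set: A]%SET|%:R.
  rewrite -sumr_const; apply: eq_bigr => k /(model_perp_full hG frame) kD.
  by apply: (model_form_lattice hG); apply: (frame_lattice_sub frame).
rewrite cardsT -natrM qc rmorphM /= mulrACA expi_conjM mulr1 => cc.
apply: (@complexI R); rewrite rmorph_nat -cc rmorphXn /= expr2; congr (_ * _).
exact/esym/conjc_real.
Qed.

End Reciprocity.

Section TorusDual.
Variables (R : realType) (r : nat) (G : group_datum R r).
Hypothesis hG : compact_simple_simply_laced G.
Variables (v : 'I_r -> 'rV[R]_r) (a : 'I_r -> nat) (n : nat).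
Hypothesis frame : orthogonal_frame G v a n.

Lemma lattice_torus_dual : root_lattice G `<=` dual_of_cols (lattice G).
Proof. by have [_ _ _ [_ _ _ lc]] := hG; move=> x xL z /lc; apply. Qed.

Lemma torus_dual_weight : dual_of_cols (lattice G) `<=` weight G.
Proof.
have [_ _ _ [_ _ cl _]] := hG; move=> x xl b bP; rewrite -(pairing_coroot hG) //.
by apply/xl/cl/int_span_mem/map_f.
Qed.

Lemma between_torus_dual : between G v (dual_of_cols (lattice G)).
Proof.
split=> [x y xl yl z zl|x /(frame_lattice_sub frame)|x /torus_dual_weight].
- by rewrite pairingB; apply: rpredB; [apply: xl | apply: yl].
- exact: lattice_torus_dual.
- exact: (weight_frame_dual hG frame).
Qed.

End TorusDual.

Theorem theorem3p1 (R : realType) (r : nat) (G : group_datum R r)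
    (hG : compact_simple_simply_laced G)
    (S : 'I_r -> 'rV[R]_r) (hS : simple_roots G S)
    (S' : 'I_r -> 'rV[R]_r) (hS' : simple_roots (langlands_dual G) S') :
  gauss_sum G S =
    (gauss_sum (langlands_dual G) S')^* * expi (pi / 4 * r%:R)
  /\
  \sum_(u \in minuscule_algebra G S) expi (pi * ip G u u) =
    (Num.sqrt (order_center (universal_cover G))%:R)%:C
      * expi (pi / 4 * r%:R).
Proof.
have [v [a [n frame]]] := orthogonal_frame_exists hG.
have hL := langlands_dual_valid hG; have frameL := dual_frame hG frame.
have hU := universal_cover_valid hG.
have bT := between_torus hG frame; have bD := between_torus_dual hG frame.
have bL := between_lattice hG frame.
have [c [c0 cK] sumE] := model_gauss_sum hG frame.
pose card H := #|model v a n H|.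
have card_gt0 H : between G v H -> (0 < card H)%N.
  move=> bH; rewrite card_gt0; apply/set0Pn; exists 0.
  by case: (model_subgroup hG frame bH).
pose Lam := root_lattice G; pose T := row_of_torus G; pose D := dual_of_cols (lattice G).
(* The torus lattice of the dual group is [D], so that the weights of the dual
   group form [lattice_dual G D]. *)
have TD : lattice_dual G T = D.
  by apply/seteqP; split=> x /(torus_dualE hG).
have LW : lattice_dual G Lam = weight G.
  apply/seteqP; split=> x xL b bP; first by apply: xL; exact: lattice_root.
  exact: (weight_lattice hG xL).
have KT := card_lattice_dual hG frame bT; rewrite TD in KT.
have KL := card_lattice_dual hG frame bL; rewrite LW in KL.
have cKT : c ^+ 2 = (card T)%:R * (card D)%:R by rewrite cK -KT natrM.
have cKL : c ^+ 2 = (card Lam)%:R * (card (weight G))%:R by rewrite cK -KL natrM.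
have sqrt_eq (x y : R) (p : nat) : 0 < x -> 0 <= y -> x ^+ 2 * p%:R = y ^+ 2 ->
    x * Num.sqrt p%:R = y.
  move=> x0 y0 xy; apply/eqP.
  rewrite -(eqrXn2 (n := 2)) ?mulr_ge0 ?sqrtr_ge0 ?(ltW x0) //.
  by rewrite exprMn sqr_sqrtr ?ler0n // xy.
have [L0 D0 T0] : [/\ (card Lam)%:R != 0 :> R[i], (card D)%:R != 0 :> R[i] &
    (card T)%:R != 0 :> R[i]] by rewrite !pnatr_eq0 -!lt0n !card_gt0.
split; last first.
  (* Reciprocity between the root lattice, on which the form is [1], and the weight
     lattice. *)
  have sumLam : \sum_(k in model v a n Lam) model_form G v a k = (card Lam)%:R.
    rewrite -sumr_const; apply: eq_bigr => k /modelP kL.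
    exact: (model_form_lattice hG).
  have := gauss_sum_lattice_dual hG frame bL.
  rewrite LW sumLam rmorph_nat mulrC => /(mulfI L0).
  rewrite (sum_minuscule hG frame hS (between_weight hG frame) (@lattice_weight _ _ _ hG))
    // setIidl; last first.
    move=> u; rewrite (minuscule_algebraE hG hS) => -[[wu _] _]; exact: wu.
  rewrite sumE -[RHS]mulr_natl => sumM; apply: (mulfI L0); rewrite -sumM mulrA.
  congr (_ * _); rewrite -(rmorph_nat (real_complex R)) -rmorphM /=; congr (_%:C).
  have OU := order_center_model hU (frame : orthogonal_frame (universal_cover G) v a n).
  have TU : row_of_torus (universal_cover G) = Lam.
    by apply/seteqP; split=> x /(coroot_latticeE hG).
  rewrite TU in OU; apply/esym/sqrt_eq; rewrite ?ltr0n ?card_gt0 ?(ltW c0) //.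
  by rewrite cKL expr2 -mulrA -!natrM [X in (_ * X)%N]mulnC -OU.
have sumG := sum_minuscule hG frame hS bD (lattice_torus_dual hG)
  (@torus_dual_weight _ _ _ hG).
have sumL := sum_minuscule hL frameL hS' (between_torus_dual hL frameL)
  (lattice_torus_dual hL) (@torus_dual_weight _ _ _ hL).
have OG := order_center_model hG frame; have OL := order_center_model hL frameL.
rewrite !dual_model in sumL OL.
have dualE (H H' : set 'rV[R]_r) : (forall x, H (x *m gram G) <-> H' x) ->
    [set x | H (x *m gram G)] = H'.
  by move=> e; apply/seteqP; split=> x /e.
rewrite (dualE _ _ (dual_root_lattice hG)) (dualE _ _ (torus_dual_dualE G)) in sumL.
rewrite (dualE _ _ (dual_weight hG)) (dualE _ _ (dual_row_of_torus hG)) in OL.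
have rec := gauss_sum_lattice_dual hG frame bD.
rewrite /gauss_sum; set MG := \sum_(u \in minuscule_group G S) _.
set ML := \sum_(u \in minuscule_group (langlands_dual G) S') _.
set z := expi _ in sumE *.
have {}sumL : \sum_(k in model v a n (lattice_dual G D)) model_form G v a k =
    (card Lam)%:R * ML.
  by rewrite mulr_natl -sumL; apply: eq_bigr => k _; rewrite dual_model_form.
rewrite sumE sumG -[_ *+ _]mulr_natl -/MG rmorphM rmorph_nat /= mulrCA in rec.
rewrite sumL [X in _ = X]mulrCA in rec.
have {rec}recML : c%:C * z * MG^*%R = (card D)%:R * ML := mulfI L0 rec.
have zz : z * z^*%R = 1 := expi_conjM _.
have recMG : c%:C * MG = (card D)%:R * (z * ML^*%R).
  have := congr1 Num.conj recML.
  rewrite !rmorphM rmorph_nat /= conjCK [(c%:C)^*%R]conjc_real => recC.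
  rewrite mulrCA -recC -[LHS]mul1r -zz; ring.
(* The orders of the two centres are [card W / card T] and [card W / card D], and
   [c ^+ 2 = card T * card D]. *)
have sqrtE : (card D)%:R * Num.sqrt (order_center (langlands_dual G))%:R =
    c * Num.sqrt (order_center G)%:R :> R.
  apply: sqrt_eq; rewrite ?ltr0n ?card_gt0 ?mulr_ge0 ?sqrtr_ge0 ?(ltW c0) //.
  rewrite exprMn sqr_sqrtr ?ler0n // cKT.
  transitivity ((card D)%:R * (card (weight G))%:R : R).
    by rewrite /card OL natrM; ring.
  by rewrite /card OG natrM; ring.
have OG0 : Num.sqrt (order_center G)%:R != 0 :> R.
  rewrite sqrtr_eq0 -ltNge ltr0n; have := card_gt0 _ (between_weight hG frame).
  by rewrite /card OG muln_gt0 => /andP[].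
have OL0 : Num.sqrt (order_center (langlands_dual G))%:R != 0 :> R.
  rewrite sqrtr_eq0 -ltNge ltr0n; have := card_gt0 _ (between_weight hG frame).
  by rewrite /card OL muln_gt0 => /andP[].
rewrite rmorphM fmorphV /=.
set sG := Num.sqrt (order_center G)%:R in sqrtE OG0 *.
set sL := Num.sqrt (order_center (langlands_dual G))%:R in sqrtE OL0 *.
have -> : (sL%:C)^*%R = sL%:C by exact: conjc_real.
have sGC : sG%:C != 0 by rewrite fmorph_eq0.
have sLC : sL%:C != 0 by rewrite fmorph_eq0.
have sqrtC : (card D)%:R * sL%:C = c%:C * sG%:C.
  by rewrite -[(card D)%:R](rmorph_nat (real_complex R)) -!rmorphM /= sqrtE.
apply: (mulfI (mulf_neq0 D0 sLC)); transitivity (c%:C * MG).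
  by rewrite sqrtC; field.
by rewrite recMG; field.
Qed.
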